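(* Let $\Omega$ be an unbounded domain in $\mathbb C^n$. If there exists a strong antipeak function at infinity for $\Omega$, then $\Omega$ is Kobayashi hyperbolic.
   Context: Strong antipeak function: for an unbounded domain $\Omega\subset\mathbb C^n$, a bounded continuous positive plurisubharmonic function $\varphi$ on $\Omega$ (so $\varphi(z)>0$ for all $z\in\Omega$) is called strong antipeak at infinity for $\Omega$ if $\lim_{\|z\|\to\infty}\varphi(z)=0$ (limit over $z\in\Omega$, $\|\cdot\|$ the Euclidean norm). Kobayashi pseudometric and hyperbolicity: for $r>0$ let $\Delta_r(0)=\{\lambda\in\mathbb C:|\lambda|<r\}$. For a complex manifold $M$, $z\in M$ and $v\in T_zM$, let $k_M(z;v)=\inf\{1/r>0:\ \exists f:\Delta_r(0)\to M \text{ holomorphic},\ f(0)=z,\ f'(0)=v\}$. $M$ is Kobayashi hyperbolic if every $p\in M$ has a neighbourhood $U$ and a constant $c>0$ with $k_M(z;v)\ge c\|v\|_g$ for all $z\in U$, $v\in T_zM$, where $\|\cdot\|_g$ is any Hermitian norm on $U$ induced from $\mathbb C^n$. For a domain $\Omega\subset\mathbb C^n$ one uses the Euclidean norm. *)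

(* Defs.v *)
From HB Require Import structures.
From mathcomp Require Import all_boot all_order all_algebra.
From mathcomp Require Export complex.
From mathcomp Require Import all_classical all_reals all_analysis.

Set Implicit Arguments.
Unset Strict Implicit.
Unset Printing Implicit Defensive.

Import Order.TTheory GRing.Theory Num.Theory.
Import numFieldNormedType.Exports.

Local Open Scope classical_set_scope.
Local Open Scope ring_scope.
Local Open Scope complex_scope.

(* The library puts a topology on the carrier of an abstract numFieldType only;
   these instances transport it, with the normed space structure, to [R[i]]. *)
HB.instance Definition _ (R : rcfType) := PseudoPointedMetric.copy R[i] R[i]^o.
HB.instance Definition _ (R : rcfType) := GRing.ComAlgebra.copy R[i] R[i]^o.
HB.instance Definition _ (R : rcfType) := Vector.copy R[i] R[i]^o.
HB.instance Definition _ (R : rcfType) := NormedModule.copy R[i] R[i]^o.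

(* C^n is ['rV[R[i]]_n] with the topology of the library (sup norm, which is
   also the Euclidean topology).  The library norm on [R[i]] takes its values
   in [R[i]], so [`|l| < r%:C] expresses |l| < r for a real r. *)
Definition enorm (R : realType) (n : nat) (z : 'rV[R[i]]_n) : R :=
  Num.sqrt (\sum_(j < n) (complex.Re (z 0 j) ^+ 2 + complex.Im (z 0 j) ^+ 2)).

Definition domain (R : realType) (n : nat) (Omega : set 'rV[R[i]]_n) : Prop :=
  [/\ Omega !=set0, open Omega & connected Omega].

Definition expi (R : realType) (t : R) : R[i] := cos t +i* sin t.

(* Subharmonic and plurisubharmonic functions are taken real-valued: the value
   -oo plays no role for positive functions.  [u] is given on all of C but only
   its values on the open set [U] matter.  The mean over the circle is an
   extended real integral; its positive part is finite by semicontinuity, and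
   the value -oo would violate the inequality. *)
Definition subharmonic (R : realType) (U : set R[i]) (u : R[i] -> R) : Prop :=
  (forall z, U z -> forall a : R, u z < a -> \forall w \near z, U w -> u w < a)
  /\
  (forall (z : R[i]) (r : R), 0 < r ->
     (forall w : R[i], `|w - z| <= r%:C -> U w) ->
     ((u z)%:E <= ((2 * pi)^-1)%R%:E *
        \int[lebesgue_measure]_(t in `[0%R, (2 * pi)%R])
           (u (z + r%:C * expi t)%R)%:E)%E).

Definition plurisubharmonic (R : realType) (n : nat)
    (Omega : set 'rV[R[i]]_n) (phi : 'rV[R[i]]_n -> R) : Prop :=
  (forall z, Omega z -> forall a : R, phi z < a ->
     \forall w \near z, Omega w -> phi w < a)
  /\
  (forall a b : 'rV[R[i]]_n,
     subharmonic [set l : R[i] | Omega (a + l *: b)]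
                 (fun l => phi (a + l *: b))).

Definition strong_antipeak (R : realType) (n : nat)
    (Omega : set 'rV[R[i]]_n) (phi : 'rV[R[i]]_n -> R) : Prop :=
  [/\ [bounded phi z | z in Omega],
      {within Omega, continuous phi},
      (forall z, Omega z -> 0 < phi z),
      plurisubharmonic Omega phi &
      forall e : R, 0 < e -> exists M : R,
        forall z, Omega z -> M < enorm z -> `|phi z| < e].

Definition holomorphic_disc (R : realType) (n : nat) (r : R)
    (Omega : set 'rV[R[i]]_n) (f : R[i] -> 'rV[R[i]]_n) : Prop :=
  forall l : R[i], `|l| < r%:C -> Omega (f l) /\ derivable f l 1.

(* The tangent space at every point of a domain of C^n is C^n. *)
Definition kobayashi (R : realType) (n : nat) (Omega : set 'rV[R[i]]_n)
    (z v : 'rV[R[i]]_n) : \bar R :=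
  ereal_inf [set (r^-1)%:E | r in [set r : R | 0 < r /\
    exists f : R[i] -> 'rV[R[i]]_n,
      [/\ holomorphic_disc r Omega f, f 0 = z & derive1 f 0 = v]]].

Definition kobayashi_hyperbolic (R : realType) (n : nat)
    (Omega : set 'rV[R[i]]_n) : Prop :=
  forall p, Omega p ->
    exists U : set 'rV[R[i]]_n, [/\ open U, U p, U `<=` Omega &
      exists2 c : R, 0 < c &
        forall z v, U z -> ((c * enorm v)%:E <= kobayashi Omega z v)%E].

(* Main.v *)
Require Import Defs.
From mathcomp Require Import all_boot all_order all_algebra.
From mathcomp Require Import all_classical all_reals all_analysis.
From mathcomp Require Import ring lra.
Set Implicit Arguments.
Unset Strict Implicit.
Unset Printing Implicit Defensive.
Import Order.TTheory GRing.Theory Num.Theory.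
Import numFieldNormedType.Exports.
Import Normc.
Local Open Scope classical_set_scope.
Local Open Scope ring_scope.
Local Open Scope complex_scope.

(** Let [phi] be the antipeak function, [phi p = 4 delta], and let [z] be close to
    [p], so that [phi > 3 delta] within [2 eta] of [z], while [phi < delta] at
    distance at least [D - 1] from [z]. Put [u y = |y - z|^2 / eta^2] and
    [X = D^2 / eta^2], [A = X / delta]. The function

      [max (A phi + min (u, X), 2 X)]

    is bounded and plurisubharmonic: far from [z] it is the constant [2 X]. Near
    [z] it equals [A phi + u], and there [u] can be replaced by [1 + ln u] where
    [u <= 1], since [ln] and the identity are tangent at [1] and
    [ln |y - z|^2] is plurisubharmonic. The resulting [G] is bounded above and has
    a logarithmic pole at [z]. For a holomorphic disc [F] of radius [r] with
    [F 0 = z], the function [G (F l) - ln |l|] is subharmonic off [0] and tends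
    to minus infinity at [0], because [F l - z = O(l)]; hence its values are at
    most its maximum on the circle of radius [rho = r / 2]. This is
    [disc_estimate]; it gives [u (F l) <= 1] on a circle of radius [theta rho],
    where [theta] does not depend on [F] or [z]. By [cauchy_estimate], [|F'(0)|]
    is at most a constant over [r], which is the hyperbolicity at [p].

    Plurisubharmonicity is a condition on complex lines, and [phi] is only
    continuous, so the subharmonicity of [phi (F l)] needs an argument. It is
    done inside the maximum principle. One maximizes the function with
    [A phi (F l)] replaced by [A phi (F l + w) - K |w|^2] over small translations
    [w] as well. At an interior maximum, let [l] vary and choose [w] so that
    [F l + w] stays on the tangent line of the disc: there [phi] satisfies the
    mean value inequality, whereas [K |w|^2] changes only by the real part of a
    holomorphic function and by a little-o of the square of the increment of
    [l]. A term [b |l|^2] then gives a contradiction ([psh_contact],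
    [psh_disc_contact]). All other terms are compared with real parts of
    holomorphic functions ([supported]).

    The two facts on holomorphic functions that are used, the mean value property
    [circle_mean] and the Cauchy estimate, come from Goursat's theorem on
    rectangles in logarithmic polar coordinates. *)

(** * Complex derivatives and the modulus *)

Section complex_analysis_basics.
Context {R : realType}.
Implicit Types (f g : R[i] -> R[i]) (l z w : R[i]).
Local Notation Re := (@complex.Re R).
Local Notation Im := (@complex.Im R).

Lemma normc_ge0 z : 0 <= normc z.
Proof. by case: z => a b; rewrite sqrtr_ge0. Qed.

Lemma sqr_normcE z : normc z ^+ 2 = Re z ^+ 2 + Im z ^+ 2.
Proof. by case: z => a b; rewrite /= sqr_sqrtr // addr_ge0 // sqr_ge0. Qed.

Lemma normr_Re_le z : `|Re z| <= normc z.
Proof. by rewrite -(ler_pXn2r (ltn0Sn 1)) ?nnegrE ?normc_ge0// sqr_normcE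
  real_normK ?num_real// lerDl sqr_ge0. Qed.

Lemma normr_Im_le z : `|Im z| <= normc z.
Proof. by rewrite -(ler_pXn2r (ltn0Sn 1)) ?nnegrE ?normc_ge0// sqr_normcE
  real_normK ?num_real// lerDr sqr_ge0. Qed.

Lemma normc_le_ReIm z : normc z <= `|Re z| + `|Im z|.
Proof.
rewrite -(ler_pXn2r (ltn0Sn 1)) ?nnegrE ?normc_ge0 ?addr_ge0//.
rewrite sqr_normcE sqrrD !real_normK ?num_real// -addrA lerD2l lerDr.
by rewrite mulrn_wge0// mulr_ge0.
Qed.

Lemma normcR (x : R) : normc x%:C = `|x|.
Proof. by rewrite /= expr0n addr0 sqrtr_sqr. Qed.

Lemma normcD z w : normc (z + w) <= normc z + normc w.
Proof. exact: le_normcD. Qed.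

Lemma normcN z : normc (- z) = normc z.
Proof. exact: complex.normcN. Qed.

Lemma normcB z w : normc (z - w) = normc (w - z).
Proof. by rewrite -opprB normcN. Qed.

Lemma normr_normcE z : `|z| = (normc z)%:C.
Proof. by []. Qed.

(** The topology of [R[i]] in terms of the real-valued modulus [normc]. *)
Lemma nbhs_normcP l (P : set R[i]) :
  nbhs l P <-> exists2 d : R, 0 < d & forall h, normc (h - l) < d -> P h.
Proof.
split.
  move=> /nbhs_ballP [e /= e0 eP].
  exists (Re e); first by move: e0; rewrite ltcE => /andP[].
  move=> h hl; apply: eP; rewrite -ball_normE /ball_ /= distrC.
  by rewrite -(RRe_real (gtr0_real e0)) ltcR.
move=> [d d0 dP]; apply/nbhs_ballP; exists d%:C; first by rewrite /= ltcR.
by move=> h; rewrite -ball_normE /ball_ /= distrC ltcR; exact: dP.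
Qed.

Lemma nbhs0_normcP (P : set R[i]) :
  nbhs (0 : R[i]) P <-> exists2 d : R, 0 < d & forall h, normc h < d -> P h.
Proof.
rewrite nbhs_normcP; split => -[d d0 dP]; exists d => // h; first by rewrite -{1}[h]subr0; exact: dP.
by rewrite subr0; exact: dP.
Qed.

Lemma continuous_normcP {T : topologicalType} (F : T -> R[i]) (x : T) :
  (forall e : R, 0 < e -> \forall y \near x, normc (F y - F x) < e) ->
  {for x, continuous F}.
Proof.
move=> H; apply/cvgrPdist_lt => e e0.
have e0' : 0 < Re e by move: e0; rewrite ltcE => /andP[].
near=> y; rewrite distrC -(RRe_real (gtr0_real e0)) ltcR.
by near: y; exact: H.
Unshelve. all: by end_near. Qed.

Lemma continuous_normcE {T : topologicalType} (F : T -> R[i]) (x : T) (e : R) :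
  {for x, continuous F} -> 0 < e -> \forall y \near x, normc (F y - F x) < e.
Proof.
move=> /cvgrPdist_lt /(_ e%:C); rewrite ltcR => H /H{}H.
near=> y; rewrite -ltcR -normr_normcE distrC; near: y; exact: H.
Unshelve. all: by end_near. Qed.

Lemma continuous_Re : continuous Re.
Proof.
move=> z; apply/(@cvgrPdist_lt _ _ _ (nbhs z) _) => e e0; apply/nbhs_normcP; exists e => // h hz.
by rewrite distrC; apply: le_lt_trans hz; have := normr_Re_le (h - z); case: h z => [? ?] [? ?].
Qed.

Lemma continuous_normc : continuous (@normc R).
Proof.
move=> z; apply/(@cvgrPdist_lt _ _ _ (nbhs z) _) => e e0; apply/nbhs_normcP; exists e => // h hz.
apply: le_lt_trans hz.
have H1 := normcD (z - h) h; have H2 := normcD (h - z) z.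
rewrite !subrK in H1 H2; rewrite ler_norml.
by rewrite (normcB z h) in H1; apply/andP; split; lra.
Qed.

Lemma continuous_complexD {T : topologicalType} (F G : T -> R) (x : T) :
  {for x, continuous F} -> {for x, continuous G} ->
  {for x, continuous (fun y => F y +i* G y)}.
Proof.
move=> cF cG; apply: continuous_normcP => e e0.
have e20 : 0 < e / 2 by rewrite divr_gt0.
move: cF cG => /cvgrPdist_lt /(_ _ e20) H1 /cvgrPdist_lt /(_ _ e20) H2.
near=> y.
apply: le_lt_trans (normc_le_ReIm _) _.
rewrite (splitr e) /= ltrD//.
  rewrite distrC; near: y; exact: H1.
rewrite distrC; near: y; exact: H2.
Unshelve. all: by end_near. Qed.

Lemma derivable_mulc f g l :
  derivable f l 1 -> derivable g l 1 -> derivable (fun x => f x * g x) l 1.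
Proof.
move=> df dg; have := @derivableM R[i] R[i]^o f g l 1 df dg.
by have -> : f * g = (fun x => f x * g x) by apply/funext.
Qed.

Lemma derivable_addc f g l :
  derivable f l 1 -> derivable g l 1 -> derivable (fun x => f x + g x) l 1.
Proof. by move=> df dg; have := @derivableD R[i] R[i]^o R[i]^o f g l 1 df dg. Qed.

Lemma derivable_invc f l :
  derivable f l 1 -> f l != 0 -> derivable (fun x => (f x)^-1) l 1.
Proof.
move=> df f0; have := @derivableV R[i] R[i]^o f l 1 f0 df.
by have -> : (fun y => (f y)^-1) = (fun x => (f x)^-1) by apply/funext.
Qed.

Lemma derivable_cstc (a : R[i]) l : derivable (fun _ : R[i] => a) l 1.
Proof. exact: derivable_cst. Qed.

Lemma derivable_idc l : derivable (fun x : R[i] => x) l 1.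
Proof. exact: derivable_id. Qed.

Lemma derivable_coord n (F : R[i] -> 'rV[R[i]]_n) l j : derivable F l 1 ->
  derivable (fun x => F x 0 j) l 1 /\
  'D_1 (fun x => F x 0 j) l = ('D_1 F l) 0 j.
Proof.
move=> dF; set a := 'D_1 F l.
have H : (fun h => h^-1 *: ((F \o shift l) (h *: (1 : R[i])) - F l)) @ 0^' --> a by [].
have : (fun h => h^-1 *: (((fun x => F x 0 j) \o shift l) (h *: (1 : R[i])) - F l 0 j))
    @ 0^' --> a 0 j.
  rewrite [X in X @ _](_ : _ = (fun M : 'rV[R[i]]_n => M 0 j) \o
    (fun h => h^-1 *: ((F \o shift l) (h *: (1 : R[i])) - F l))); last first.
    by apply/funext => h /=; rewrite !mxE.
  apply: cvg_comp H _; exact: (@coord_continuous _ _ _ 0 j a).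
by move=> Hj; split; [apply/cvg_ex; exists (a 0 j)|exact/cvg_lim].
Qed.

Lemma derivable_continuousc f l : derivable f l 1 -> {for l, continuous f}.
Proof. by move=> /derivable1_diffP H; exact: differentiable_continuous. Qed.

Lemma derivable_littleo f l : derivable f l 1 -> forall e : R, 0 < e ->
  \forall h \near (0 : R[i]), normc (f (l + h) - f l - h * 'D_1 f l) <= e * normc h.
Proof.
move=> /cvg_ex[/= a H] e e0.
have -> : 'D_1 f l = a by apply/cvg_lim.
move: H => /cvgrPdist_le /(_ (e%:C)); rewrite ltcR => /(_ e0).
rewrite /dnbhs /within /= => /nbhs0_normcP[d d0 dP].
apply/nbhs0_normcP; exists d => // h hd.
have [->|h0] := eqVneq h 0.
  by rewrite addr0 subrr mul0r subr0 normc0 mulr0.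
have := dP h hd h0.
have -> : (h * 1 + l) = l + h by rewrite mulr1 addrC.
rewrite normr_normcE lecR => H1.
have -> : f (l + h) - f l - h * a = - (h * (a - h^-1 * (f (l + h) - f l))).
  by rewrite mulrBr mulrA mulfV// mul1r opprB.
by rewrite normcN normcM mulrC ler_wpM2r ?normc_ge0.
Qed.

End complex_analysis_basics.

(** * Goursat's theorem on rectangles *)

Section interval_integrals.
Context {R : realType}.
Notation mu := (@lebesgue_measure R).
Implicit Types (f g : R -> R) (a b c : R).

Lemma continuous_itv_integrable f a b :
  (forall x, a <= x <= b -> {for x, continuous f}) ->
  mu.-integrable `[a, b] (EFin \o f).
Proof.
move=> cf; apply: continuous_compact_integrable; first exact: segment_compact.
apply: continuous_in_subspaceT => x /set_mem /=; rewrite in_itv/=; exact: cf.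
Qed.

Lemma Rintegral_itv_split f a c b : a <= c <= b ->
  (forall x, a <= x <= b -> {for x, continuous f}) ->
  \int[mu]_(x in `[a, b]) f x =
  \int[mu]_(x in `[a, c]) f x + \int[mu]_(x in `[c, b]) f x.
Proof.
move=> /andP[ac cb] cf; have fab := continuous_itv_integrable cf.
have := @Rintegral_itvB R f (BLeft a) (BRight b) c fab.
rewrite !bnd_simp => /(_ ac cb).
rewrite Rintegral_itv_obnd_cbnd; last first.
  apply: integrableS fab => //; apply: subset_itvr => //; by rewrite bnd_simp.
move=> <-; by rewrite subrKC.
Qed.

(** A function within [e] of the constant [k] has integral within [e (b - a)]
    of [k (b - a)]. *)
Lemma Rintegral_itv_approx f a b k e : a <= b ->
  (forall x, a <= x <= b -> {for x, continuous f}) ->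
  (forall x, a <= x <= b -> `|f x - k| <= e) ->
  `|\int[mu]_(x in `[a, b]) f x - k * (b - a)| <= e * (b - a).
Proof.
move=> ab cf fk; have fab := continuous_itv_integrable cf.
have cst_int (r : R) : mu.-integrable `[a, b] (EFin \o (fun=> r)).
  by apply: continuous_itv_integrable => x _; exact: cst_continuous.
have mab : fine (mu `[a, b]) = b - a.
  by rewrite lebesgue_measure_itv/= lte_fin; case: ltgtP ab => // ->; rewrite subrr.
have Icst (r : R) : \int[mu]_(x in `[a, b]) r = r * (b - a).
  by rewrite Rintegral_cst// -[X in _ * fine X]/(mu `[a, b]) mab.
rewrite ler_norml lerBrDr lerBlDr.
have -> : - (e * (b - a)) + k * (b - a) = (k - e) * (b - a) by ring.
have -> : e * (b - a) + k * (b - a) = (k + e) * (b - a) by ring.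
rewrite -!Icst; apply/andP; split; apply: le_Rintegral => // x /=;
  rewrite in_itv/= => /fk; rewrite ler_norml; lra.
Qed.

End interval_integrals.

Section goursat.
Context {R : realType}.
Notation mu := (@lebesgue_measure R).

(** The real part of the integral of [(u + i v) dz], that is, of [u dx - v dy],
    along the boundary of the rectangle of lower left corner [(x, y)] and sides
    [p] and [q], oriented counterclockwise. *)
Definition rect_integral (u v : R -> R -> R) (x y p q : R) : R :=
  \int[mu]_(s in `[x, x + p]) u s y - \int[mu]_(s in `[x, x + p]) u s (y + q) +
  (\int[mu]_(t in `[y, y + q]) v x t - \int[mu]_(t in `[y, y + q]) v (x + p) t).

(** [(u, v)] has at [(X, Y)] a differential satisfying the Cauchy-Riemann
    equations. *)
Definition cauchy_riemann_at (u v : R -> R -> R) (X Y : R) :=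
  exists a b : R, forall e, 0 < e -> exists2 d, 0 < d & forall x y,
    `|x - X| < d -> `|y - Y| < d ->
    `|u x y - u X Y - (a * (x - X) - b * (y - Y))| <= e * (`|x - X| + `|y - Y|)
    /\
    `|v x y - v X Y - (b * (x - X) + a * (y - Y))| <= e * (`|x - X| + `|y - Y|).

Lemma cauchy_riemann_continuous u v X Y : cauchy_riemann_at u v X Y ->
  [/\ {for X, continuous (fun x => u x Y)}, {for Y, continuous (fun y => u X y)},
      {for X, continuous (fun x => v x Y)} & {for Y, continuous (fun y => v X y)}].
Proof.
move=> [a [b /(_ 1 ltr01)[d d0 H]]].
pose M := `|a| + `|b| + 1.
have M0 : 0 < M by rewrite ltr_wpDl// addr_ge0.
have aux (g : R -> R) (Z c : R) : `|c| <= `|a| + `|b| ->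
    (forall z, `|z - Z| < d -> `|g z - g Z - c * (z - Z)| <= `|z - Z|) ->
    {for Z, continuous g}.
  move=> cab Hg; apply/cvgrPdist_lt => e e0.
  have : 0 < Num.min d (e / M) by rewrite lt_min d0 divr_gt0.
  move=> m0; near=> z.
  have : `|z - Z| < Num.min d (e / M).
    by rewrite distrC; near: z; apply/nbhs_ballP; exists (Num.min d (e / M)).
  rewrite lt_min => /andP[zd]; rewrite ltr_pdivlMr// => zM.
  rewrite distrC; apply: le_lt_trans zM.
  have -> : g z - g Z = g z - g Z - c * (z - Z) + c * (z - Z) by rewrite subrK.
  have -> : `|z - Z| * M = `|z - Z| + (`|a| + `|b|) * `|z - Z| by rewrite /M; ring.
  rewrite (le_trans (ler_normD _ _))// lerD//; first exact: Hg.
  by rewrite normrM ler_wpM2r.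
split.
- apply: (aux _ _ a) => [|z zX]; first by rewrite lerDl.
  by have := H z Y zX; rewrite !subrr normr0 ?mulr0 ?subr0 ?sub0r ?addr0 ?add0r ?mul1r ?mulNr => /(_ d0)[].
- apply: (aux _ _ (- b)) => [|z zX]; first by rewrite normrN lerDr.
  by have := H X z; rewrite !subrr normr0 ?mulr0 ?subr0 ?sub0r ?addr0 ?add0r ?mul1r ?mulNr => /(_ d0 zX)[].
- apply: (aux _ _ b) => [|z zX]; first by rewrite lerDr.
  by have := H z Y zX; rewrite !subrr normr0 ?mulr0 ?subr0 ?sub0r ?addr0 ?add0r ?mul1r ?mulNr => /(_ d0)[].
- apply: (aux _ _ a) => [|z zX]; first by rewrite lerDl.
  by have := H X z; rewrite !subrr normr0 ?mulr0 ?subr0 ?sub0r ?addr0 ?add0r ?mul1r ?mulNr => /(_ d0 zX)[].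
Unshelve. all: by end_near. Qed.

Section on_a_rectangle.
Variables (u v : R -> R -> R) (x0 y0 p q : R).
Hypotheses (p0 : 0 <= p) (q0 : 0 <= q).
Hypothesis CR : forall X Y, x0 <= X <= x0 + p -> y0 <= Y <= y0 + q ->
  cauchy_riemann_at u v X Y.

Let inside x y s t := [/\ x0 <= x, x + s <= x0 + p, y0 <= y & y + t <= y0 + q].

Lemma rect_integral_quarter x y s t : 0 <= s -> 0 <= t ->
  inside x y (s + s) (t + t) ->
  rect_integral u v x y (s + s) (t + t) =
  rect_integral u v x y s t + rect_integral u v (x + s) y s t +
  rect_integral u v x (y + t) s t + rect_integral u v (x + s) (y + t) s t.
Proof.
move=> s0 t0 [H1 H2 H3 H4].
have cu Y : y0 <= Y <= y0 + q -> forall z, x <= z <= x + (s + s) ->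
    {for z, continuous (fun z => u z Y)}.
  move=> HY z /andP[z1 z2]; have [] // := cauchy_riemann_continuous (@CR z Y _ HY).
  by apply/andP; split; lra.
have cv X : x0 <= X <= x0 + p -> forall z, y <= z <= y + (t + t) ->
    {for z, continuous (fun z => v X z)}.
  move=> HX z /andP[z1 z2]; have [] // := cauchy_riemann_continuous (@CR X z HX _).
  by apply/andP; split; lra.
have Eu Y : y0 <= Y <= y0 + q ->
    \int[mu]_(z in `[x, x + (s + s)]) u z Y =
    \int[mu]_(z in `[x, x + s]) u z Y + \int[mu]_(z in `[x + s, x + (s + s)]) u z Y.
  move=> HY; apply: Rintegral_itv_split; last exact: cu.
  by apply/andP; split; lra.
have Ev X : x0 <= X <= x0 + p ->
    \int[mu]_(z in `[y, y + (t + t)]) v X z =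
    \int[mu]_(z in `[y, y + t]) v X z + \int[mu]_(z in `[y + t, y + (t + t)]) v X z.
  move=> HY; apply: Rintegral_itv_split; last exact: cv.
  by apply/andP; split; lra.
rewrite /rect_integral -!addrA.
rewrite Eu; last by apply/andP; split; lra.
rewrite Eu; last by apply/andP; split; lra.
rewrite Ev; last by apply/andP; split; lra.
rewrite Ev; last by apply/andP; split; lra.
ring.
Qed.

Lemma rect_integral_small X Y e : x0 <= X <= x0 + p -> y0 <= Y <= y0 + q ->
  0 < e -> exists2 d, 0 < d & forall x y s t, 0 <= s < d -> 0 <= t < d ->
    inside x y s t -> x <= X <= x + s -> y <= Y <= y + t ->
    `|rect_integral u v x y s t| <= e * (s + t) ^+ 2.
Proof.
move=> HX HY e0; have [a [b H]] := CR HX HY.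
have e20 : 0 < e / 2 by rewrite divr_gt0.
have [d d0 {}H] := H _ e20; exists d => // x y s t /andP[s0 sd] /andP[t0 td].
move=> [H1 H2 H3 H4] /andP[X1 X2] /andP[Y1 Y2].
have loc z w : x <= z <= x + s -> y <= w <= y + t ->
  `|u z w - u X Y - (a * (z - X) - b * (w - Y))| <= e / 2 * (s + t) /\
  `|v z w - v X Y - (b * (z - X) + a * (w - Y))| <= e / 2 * (s + t).
  move=> /andP[z1 z2] /andP[w1 w2].
  have zX : `|z - X| <= s by rewrite ler_norml; apply/andP; split; lra.
  have wY : `|w - Y| <= t by rewrite ler_norml; apply/andP; split; lra.
  have [Hu Hv] := H z w (le_lt_trans zX sd) (le_lt_trans wY td).
  by split; [apply: le_trans Hu _|apply: le_trans Hv _];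
    (apply: ler_wpM2l; [exact: ltW|exact: lerD]).
have cu Z : y0 <= Z <= y0 + q -> forall z, x <= z <= x + s ->
    {for z, continuous (fun z => u z Z)}.
  move=> HZ z /andP[z1 z2]; have [] // := cauchy_riemann_continuous (@CR z Z _ HZ).
  by apply/andP; split; lra.
have cv Z : x0 <= Z <= x0 + p -> forall z, y <= z <= y + t ->
    {for z, continuous (fun z => v Z z)}.
  move=> HZ z /andP[z1 z2]; have [] // := cauchy_riemann_continuous (@CR Z z HZ _).
  by apply/andP; split; lra.
have xx : x <= x <= x + s by rewrite lexx lerDl.
have yy : y <= y <= y + t by rewrite lexx lerDl.
have xxs : x <= x + s <= x + s by rewrite lexx lerDl s0.
have yyt : y <= y + t <= y + t by rewrite lexx lerDl t0.
have y1 : y0 <= y <= y0 + q by rewrite H3 (le_trans _ H4)// lerDl.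
have yt1 : y0 <= y + t <= y0 + q by rewrite H4 (le_trans H3)// lerDl.
have x1 : x0 <= x <= x0 + p by rewrite H1 (le_trans _ H2)// lerDl.
have xs1 : x0 <= x + s <= x0 + p by rewrite H2 (le_trans H1)// lerDl.
have Iu : `|\int[mu]_(z in `[x, x + s]) (u z y - u z (y + t)) - (b * t) * (x + s - x)|
    <= e * (s + t) * (x + s - x).
  apply: Rintegral_itv_approx; first by lra.
    by move=> z Hz; apply: continuousB; exact: cu.
  move=> z Hz.
  have [A1 _] := loc z y Hz yy.
  have [A2 _] := loc z (y + t) Hz yyt.
  move: A1 A2; rewrite !ler_norml => /andP[G1 G2] /andP[G3 G4].
  clear -G1 G2 G3 G4; by apply/andP; split; lra.
have Iv : `|\int[mu]_(z in `[y, y + t]) (v x z - v (x + s) z) - (- b * s) * (y + t - y)|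
    <= e * (s + t) * (y + t - y).
  apply: Rintegral_itv_approx; first by lra.
    by move=> z Hz; apply: continuousB; exact: cv.
  move=> z Hz.
  have [_ A1] := loc x z xx Hz.
  have [_ A2] := loc (x + s) z xxs Hz.
  move: A1 A2; rewrite !ler_norml => /andP[G1 G2] /andP[G3 G4].
  clear -G1 G2 G3 G4; by apply/andP; split; lra.
rewrite !RintegralB// in Iu Iv; try by apply: continuous_itv_integrable; auto.
rewrite /rect_integral; move: Iu Iv.
set I1 := Rintegral _ _ _; set I2 := Rintegral _ _ _; set I3 := Rintegral _ _ _.
set I4 := Rintegral _ _ _; rewrite !ler_norml => /andP[G1 G2] /andP[G3 G4].
clear -G1 G2 G3 G4; by apply/andP; split; lra.
Qed.

(** Goursat's bisection: a rectangle with nonzero integral contains quarters of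
    every generation with integral at least proportional to their area; these
    shrink to a point, where differentiability makes the integral smaller. *)
Lemma goursat_rectangle : rect_integral u v x0 y0 p q = 0.
Proof.
apply/eqP; apply: contrapT => /negP J0.
pose K := `|rect_integral u v x0 y0 p q|.
have K0 : 0 < K by rewrite normr_gt0.
pose P n := p / 2 ^+ n; pose Q n := q / 2 ^+ n.
have pow0 n : 0 < 2 ^+ n :> R by rewrite exprn_gt0.
have P0 n : 0 <= P n by rewrite divr_ge0// ltW.
have Q0 n : 0 <= Q n by rewrite divr_ge0// ltW.
have PS n : P n = P n.+1 + P n.+1.
  by rewrite /P exprS; field; rewrite gt_eqF.
have QS n : Q n = Q n.+1 + Q n.+1.
  by rewrite /Q exprS; field; rewrite gt_eqF.
(* corners of the n-th generation rectangles on which the integral is large *)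
pose bad n (z : R * R) := inside z.1 z.2 (P n) (Q n) /\
  K / 4 ^+ n <= `|rect_integral u v z.1 z.2 (P n) (Q n)|.
have step (nz : nat * (R * R)) : exists z' : R * R, bad nz.1 nz.2 ->
    [/\ bad nz.1.+1 z',
      nz.2.1 <= z'.1, z'.1 + P nz.1.+1 <= nz.2.1 + P nz.1,
      nz.2.2 <= z'.2 & z'.2 + Q nz.1.+1 <= nz.2.2 + Q nz.1].
  case: nz => n [x y] /=.
  have [[ins big]|nb] := pselect (bad n (x, y)); last by exists (x, y).
  rewrite /= in ins big.
  have E := @rect_integral_quarter x y (P n.+1) (Q n.+1) (P0 _) (Q0 _).
  rewrite -PS -QS in E; have {}E := E ins.
  case: ins => H1 H2 H3 H4.
  have := PS n; have := QS n; have := P0 n.+1; have := Q0 n.+1 => Qn Pn QSn PSn.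
  have H4n : K / 4 ^+ n = (K / 4 ^+ n.+1) *+ 4.
    by rewrite exprS; field; rewrite gt_eqF// exprn_gt0.
  have inq x' y' : x' = x \/ x' = x + P n.+1 -> y' = y \/ y' = y + Q n.+1 ->
      K / 4 ^+ n.+1 <= `|rect_integral u v x' y' (P n.+1) (Q n.+1)| ->
      [/\ bad n.+1 (x', y'), x <= x', x' + P n.+1 <= x + P n,
       y <= y' & y' + Q n.+1 <= y + Q n].
    have [x'1 y'1] : (x' = x \/ x' = x + P n.+1 -> x <= x' /\ x' + P n.+1 <= x + P n) /\
        (y' = y \/ y' = y + Q n.+1 -> y <= y' /\ y' + Q n.+1 <= y + Q n).
      by clear -Qn Pn QSn PSn; split => -[->|->]; split; lra.
    move=> /x'1[a1 a2] /y'1[a3 a4] B; split => //; split => //.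
    by split; [exact: le_trans a1|exact: le_trans H2|exact: le_trans a3|exact: le_trans H4].
  move: E big H4n; set J := rect_integral u v x y (P n) (Q n).
  set K4 := K / 4 ^+ n.+1; set J1 := rect_integral u v x y _ _.
  set J2 := rect_integral u v (x + _) y _ _.
  set J3 := rect_integral u v x (y + _) _ _.
  set J4 := rect_integral u v (x + _) (y + _) _ _ => E big H4n.
  have [B1|B1] := leP K4 `|J1|; first by exists (x, y) => _; apply: inq; auto.
  have [B2|B2] := leP K4 `|J2|; first by exists (x + P n.+1, y) => _; apply: inq; auto.
  have [B3|B3] := leP K4 `|J3|; first by exists (x, y + Q n.+1) => _; apply: inq; auto.
  have [B4|B4] := leP K4 `|J4|.
    by exists (x + P n.+1, y + Q n.+1) => _; apply: inq; auto.
  exfalso; move: big; rewrite H4n E leNgt => /negP; apply.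
  rewrite (le_lt_trans (ler_normD _ _))//.
  have := ler_normD (J1 + J2) J3; have := ler_normD J1 J2.
  lra.
have [g Hg] := choice step.
pose z n := nat_rect (fun=> (R * R)%type) (x0, y0) (fun n z => g (n, z)) n.
have zS n : z n.+1 = g (n, z n) by [].
have badz n : bad n (z n).
  elim: n => [|n IH]; last by rewrite zS; have [] := Hg (n, z n) IH.
  by rewrite /bad /= /P /Q expr0 !divr1; split.
have mono n m : (n <= m)%N ->
    [/\ (z n).1 <= (z m).1, (z m).1 + P m <= (z n).1 + P n,
        (z n).2 <= (z m).2 & (z m).2 + Q m <= (z n).2 + Q n].
  elim: m => [|m IH]; first by rewrite leqn0 => /eqP ->.
  rewrite leq_eqVlt => /predU1P[-> //|]; rewrite ltnS => /IH[A1 A2 A3 A4].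
  by have [_] := Hg (m, z m) (badz m); rewrite -zS /= => B1 B2 B3 B4; split; lra.
have lim (w : nat -> R) (W : nat -> R) : (forall n, 0 <= W n) ->
    (forall n m, (n <= m)%N -> w n <= w m /\ w m + W m <= w n + W n) ->
    exists L, forall n, w n <= L <= w n + W n.
  move=> W0 wm; exists (sup (range w)) => n.
  have ub m k : w k <= w m + W m.
    have [mk|km] := leP m k.
      by have [_] := wm _ _ mk; have := W0 k; lra.
    by have [+ _] := wm _ _ (ltnW km); have := W0 m; lra.
  apply/andP; split.
    apply: ub_le_sup; last by exists n.
    by exists (w 0 + W 0) => _ [k _ <-].
  apply: ge_sup; first by exists (w 0), 0%N.
  by move=> _ [k _ <-].
have [X HX] := lim (fun n => (z n).1) P P0 (fun n m nm => 
  let: And4 A B _ _ := mono n m nm in conj A B).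
have [Y HY] := lim (fun n => (z n).2) Q Q0 (fun n m nm => 
  let: And4 _ _ A B := mono n m nm in conj A B).
pose e := K / (2 * ((p + q) ^+ 2 + 1)).
have pq0 : 0 < (p + q) ^+ 2 + 1 by rewrite ltr_wpDl// sqr_ge0.
have e0 : 0 < e by rewrite divr_gt0// mulr_gt0.
have HX0 : x0 <= X <= x0 + p.
  by have := HX 0%N; rewrite /= /P expr0 divr1.
have HY0 : y0 <= Y <= y0 + q.
  by have := HY 0%N; rewrite /= /Q expr0 divr1.
have [d d0 Hd] := rect_integral_small HX0 HY0 e0.
have [n pqn] : exists n, (p + q) < d * 2 ^+ n.
  exists (Num.bound ((p + q) / d)).
  rewrite mulrC -ltr_pdivrMr//; apply: lt_le_trans (archi_boundP _) _.
    by rewrite divr_ge0 ?addr_ge0// ltW.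
  by rewrite -natrX ler_nat ltnW// ltn_expl.
have Pd : P n < d by rewrite /P ltr_pdivrMr//; lra.
have Qd : Q n < d by rewrite /Q ltr_pdivrMr//; lra.
have [ins big] := badz n.
have := Hd (z n).1 (z n).2 (P n) (Q n).
rewrite P0 Pd Q0 Qd => /(_ isT isT ins (HX n) (HY n)) small.
have := le_trans big small; rewrite leNgt => /negP; apply.
have -> : e * (P n + Q n) ^+ 2 = e * (p + q) ^+ 2 / 4 ^+ n.
  rewrite /P /Q -mulrDl exprMn -[4]/((2 ^ 2)%:R) natrX -!exprM mulnC exprVn mulrA.
  by rewrite -exprM.
rewrite ltr_pM2r ?invr_gt0 ?exprn_gt0// /e mulrAC ltr_pdivrMr ?mulr_gt0//.
by rewrite ltr_pM2l//; have := sqr_ge0 (p + q); lra.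
Qed.

End on_a_rectangle.
End goursat.

(** * The mean value property of holomorphic functions *)

Section mean_value_property.
Context {R : realType}.
Notation mu := (@lebesgue_measure R).
Local Notation Re := (@complex.Re R).
Local Notation Im := (@complex.Im R).

Lemma is_derive_littleo (f : R -> R) (x df : R) : is_derive x 1 f df ->
  forall e, 0 < e -> exists2 d, 0 < d & forall h, `|h| < d ->
    `|f (x + h) - f x - df * h| <= e * `|h|.
Proof.
move=> Df e e0.
have [/cvg_ex[a H] E] := Df.
have {}E : a = df by rewrite -E; apply/esym/cvg_lim.
move: H => /cvgrPdist_le /(_ _ e0).
rewrite /dnbhs /within /= => /nbhs_ballP[d /= d0 dP].
exists d => // h hd.
have [->|h0] := eqVneq h 0; first by rewrite addr0 mulr0 subr0 subrr normr0 mulr0.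
have := dP h; rewrite -ball_normE /= sub0r normrN => /(_ hd h0).
rewrite E [h *: 1]mulr1 [h + x]addrC => H1.
have -> : f (x + h) - f x - df * h = - (h * (df - h^-1 * (f (x + h) - f x))).
  by rewrite mulrBr mulrA mulfV// mul1r opprB [h * df]mulrC.
by rewrite normrN normrM mulrC ler_wpM2r.
Qed.

Lemma normc_expi (t : R) : normc (expi t) = 1.
Proof. by rewrite /= cos2Dsin2 sqrtr1. Qed.

Lemma continuous_expi : continuous (@expi R).
Proof.
move=> t; apply: continuous_complexD; [exact: continuous_cos|exact: continuous_sin].
Qed.

(** The complex exponential of [x + i y], used as logarithmic polar
    coordinates on the punctured plane. *)
Definition cexp (x y : R) : R[i] := (expR x)%:C * expi y.

Lemma normc_cexp x y : normc (cexp x y) = expR x.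
Proof. by rewrite normcM normc_expi mulr1 normcR gtr0_norm// expR_gt0. Qed.

Lemma cexpD x y h k : cexp (x + h) (y + k) = cexp x y * cexp h k.
Proof.
rewrite /cexp expRD rmorphM/=.
have -> : expi (y + k) = expi y * expi k.
  by rewrite /expi cosD sinD; apply/eqP; rewrite eq_complex/= [cos y * sin k + _]addrC !eqxx.
ring.
Qed.

Lemma cexp_littleo0 (e : R) : 0 < e -> exists2 d, 0 < d & forall h k,
  `|h| < d -> `|k| < d ->
  normc (cexp h k - 1 - (h +i* k)) <= e * (`|h| + `|k|).
Proof.
move=> e0; have [c [c0 ce c1]] : exists c, [/\ 0 < c, c <= e / 8 & c <= 1 / 8].
  exists (Num.min (e / 8) (1 / 8)).
  by rewrite lt_min !divr_gt0// !ge_min !lexx orbT.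
have [d1 d10 H1] := is_derive_littleo (is_derive_expR 0) c0.
have [d2 d20 H2] := is_derive_littleo (is_derive_cos 0) c0.
have [d3 d30 H3] := is_derive_littleo (is_derive_sin 0) c0.
exists (Num.min (Num.min d1 (Num.min d2 d3)) c).
  by rewrite !lt_min d10 d20 d30 c0.
move=> h k; rewrite !lt_min => /andP[/and3P[h1 h2 h3] hc] /andP[/and3P[k1 k2 k3] kc].
have {H1} := H1 h h1; have {H2} := H2 k k2; have {H3} := H3 k k3.
rewrite !add0r sin0 cos0 expR0 oppr0 mul0r !mul1r !subr0 => S C E.
rewrite (le_trans (normc_le_ReIm _))//= !mul0r subr0 addr0 subr0.
have A0 : 0 <= `|h| by exact: normr_ge0.
have B0 : 0 <= `|k| by exact: normr_ge0.
have cosk : `|cos k| <= 1 by rewrite ler_norml cos_geN1 cos_le1.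
have re : `|expR h * cos k - 1 - h| <= c * `|h| + 2 * (c * `|k|).
  have -> : expR h * cos k - 1 - h = (expR h - 1 - h) * cos k + (1 + h) * (cos k - 1) by ring.
  rewrite (le_trans (ler_normD _ _))// !normrM lerD//.
    by rewrite -[leRHS]mulr1 ler_pM.
  rewrite ler_pM// (le_trans (ler_normD _ _))// normr1; lra.
have eh : `|expR h - 1| <= 2 * c.
  have -> : expR h - 1 = (expR h - 1 - h) + h by ring.
  rewrite (le_trans (ler_normD _ _))//.
  have : c * `|h| <= c by rewrite ger_pMr//; lra.
  lra.
have im : `|expR h * sin k - k| <= 2 * (c * `|k|) + 2 * c * `|k|.
  have -> : expR h * sin k - k = expR h * (sin k - k) + (expR h - 1) * k by ring.
  rewrite (le_trans (ler_normD _ _))// !normrM lerD//; last by rewrite ler_wpM2r.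
  rewrite ler_pM//; last by rewrite addr0 in S.
  rewrite gtr0_norm ?expR_gt0//.
  by move: eh; rewrite ler_norml => /andP[_]; lra.
have cA : c * `|h| <= e / 8 * `|h| by rewrite ler_wpM2r.
have cB : c * `|k| <= e / 8 * `|k| by rewrite ler_wpM2r.
have : 0 <= e * `|h| by rewrite mulr_ge0// ltW.
have : 0 <= e * `|k| by rewrite mulr_ge0// ltW.
clear -cA cB re im; lra.
Qed.

(** The Cauchy-Riemann equations for [i g (exp (x + i y))]. The factor [i] makes
    the real part of [g] the second component, which [rect_integral] integrates
    along the vertical sides. *)
Lemma derivable_cexp_cauchy_riemann (g : R[i] -> R[i]) (X Y : R) :
  derivable g (cexp X Y) 1 ->
  cauchy_riemann_at (fun x y => - Im (g (cexp x y))) (fun x y => Re (g (cexp x y))) X Y.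
Proof.
move=> dg; set z := cexp X Y; set D := 'D_1 g z.
pose E := D * z; exists (- Im E), (Re E) => e e0.
pose N := normc z; have N0 : 0 < N by rewrite /N normc_cexp expR_gt0.
pose M := normc D; have M0 : 0 <= M by rewrite normc_ge0.
have e1 : 0 < e / (4 * N) by rewrite divr_gt0// mulr_gt0.
have /nbhs0_normcP[d1 d10 H1] := derivable_littleo dg e1.
pose c := Num.min 1 (e / (2 * (M * N + 1))).
have c0 : 0 < c by rewrite lt_min ltr01 divr_gt0// mulr_gt0// ltr_wpDl// mulr_ge0// ltW.
have [d2 d20 H2] := cexp_littleo0 c0.
exists (Num.min d2 (d1 / (4 * N))); first by rewrite lt_min d20 divr_gt0// mulr_gt0.
move=> x y; rewrite !lt_min => /andP[hx hx1] /andP[ky ky1].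
set h := x - X in hx hx1 *; set k := y - Y in ky ky1 *.
have xE : x = X + h by rewrite /h subrKC.
have yE : y = Y + k by rewrite /k subrKC.
have zE : cexp x y = z * cexp h k by rewrite xE yE cexpD.
have := H2 h k hx ky; set S := `|h| + `|k|; set o := cexp h k - 1 - _ => Ho.
have S0 : 0 <= S by rewrite addr_ge0.
have hkS : normc (h +i* k) <= S by exact: normc_le_ReIm.
pose w := cexp x y - z.
have wE : w = z * ((h +i* k) + o).
  by rewrite /w zE /o; ring.
have wS : normc w <= N * (2 * S).
  rewrite wE normcM ler_wpM2l ?normc_ge0// (le_trans (normcD _ _))//.
  have : c * S <= S by rewrite ler_piMl// /c ge_min lexx.
  by lra.
have wd : normc w < d1.
  apply: le_lt_trans wS _; rewrite ltr_pdivlMr in hx1; last by rewrite mulr_gt0.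
  rewrite ltr_pdivlMr in ky1; last by rewrite mulr_gt0.
  by rewrite /S; lra.
have {H1} := H1 w wd; rewrite -/D.
have -> : z + w = cexp x y by rewrite /w subrKC.
move=> Hg.
have main : normc (g (cexp x y) - g z - E * (h +i* k)) <= e * S.
  have -> : g (cexp x y) - g z - E * (h +i* k) =
      (g (cexp x y) - g z - w * D) + E * o by rewrite /E wE; ring.
  rewrite (le_trans (normcD _ _))//.
  have A1 : e / (4 * N) * normc w <= e * S / 2.
    rewrite (le_trans (ler_wpM2l _ wS)) ?(ltW e1)//.
    by rewrite le_eqVlt; apply/orP; left; apply/eqP; field; rewrite gt_eqF.
  have A2 : normc (E * o) <= e * S / 2.
    rewrite /E (normcM (D * z)) (normcM D z) -/M -/N
      (le_trans (ler_wpM2l _ Ho)) ?mulr_ge0 ?normc_ge0 ?(ltW N0)//.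
    have -> : M * N * (c * S) = M * N * c * S by ring.
    have -> : e * S / 2 = e / 2 * S by ring.
    apply: ler_wpM2r => //.
    have MN : 0 < M * N + 1 by rewrite ltr_wpDl// mulr_ge0// ltW.
    have cle : c <= e / (2 * (M * N + 1)) by rewrite /c ge_min lexx orbT.
    rewrite (le_trans (ler_wpM2l _ cle)) ?mulr_ge0 ?(ltW N0)//.
    have -> : M * N * (e / (2 * (M * N + 1))) = e / 2 * ((M * N) / (M * N + 1)).
      by field; rewrite gt_eqF.
    rewrite ger_pMr ?divr_gt0// ler_pdivrMr// mul1r lerDl//.
  lra.
split.
  apply: le_trans main; rewrite -normrN; apply: le_trans (normr_Im_le _).
  rewrite le_eqVlt; apply/orP; left; apply/eqP; congr `|_|.
  by case: (g (cexp x y)) (g z) (E) => [? ?] [? ?] [? ?] /=; ring.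
apply: le_trans main; apply: le_trans (normr_Re_le _).
rewrite le_eqVlt; apply/orP; left; apply/eqP; congr `|_|.
by case: (g (cexp x y)) (g z) (E) => [? ?] [? ?] [? ?] /=; ring.
Qed.

Section circle.
Variables (g : R[i] -> R[i]) (r : R).
Hypothesis dg : forall l, 0 < normc l < r -> derivable g l 1.

Lemma continuous_circle (s : R) : 0 < s < r ->
  continuous (fun t => Re (g (s%:C * expi t))).
Proof.
move=> /andP[s0 sr] t.
have n : normc (s%:C * expi t) = s by rewrite normcM normc_expi mulr1 normcR gtr0_norm.
apply: (@continuous_comp _ _ _ (fun t => g (s%:C * expi t)) (@complex.Re R)); last exact: continuous_Re.
apply: (@continuous_comp _ _ _ (fun t => s%:C * expi t) g).
  apply: continuous_normcP => e e0.
  have := continuous_normcE (@continuous_expi t) (divr_gt0 e0 s0).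
  apply: filterS => y; rewrite ltr_pdivlMr// => H.
  by rewrite -mulrBr normcM normcR gtr0_norm// mulrC.
by apply/derivable_continuousc/dg; rewrite n s0.
Qed.

(** In logarithmic polar coordinates an annulus becomes a rectangle; the
    integrals along its horizontal sides cancel by periodicity, so that Goursat's
    theorem equates the integrals over the two circles. *)
Lemma circle_mean_cst (s1 s2 : R) : 0 < s1 -> s1 <= s2 -> s2 < r ->
  \int[mu]_(t in `[0, 2 * pi]) Re (g (s1%:C * expi t)) =
  \int[mu]_(t in `[0, 2 * pi]) Re (g (s2%:C * expi t)).
Proof.
move=> s10 s12 s2r; have s20 : 0 < s2 by exact: lt_le_trans s12.
have p0 : 0 <= ln s2 - ln s1 by rewrite subr_ge0 ler_ln.
have q0 : 0 <= 2 * pi :> R by rewrite mulr_ge0// pi_ge0.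
have := @goursat_rectangle R (fun x y => - Im (g (cexp x y))) (fun x y => Re (g (cexp x y)))
  (ln s1) 0 (ln s2 - ln s1) (2 * pi) p0 q0.
have CR : forall X Y, ln s1 <= X <= ln s1 + (ln s2 - ln s1) ->
    0 <= Y <= 0 + 2 * pi ->
    cauchy_riemann_at (fun x y => - Im (g (cexp x y))) (fun x y => Re (g (cexp x y))) X Y.
  move=> X Y /andP[_ HX] _; apply/derivable_cexp_cauchy_riemann/dg.
  rewrite normc_cexp expR_gt0/= (le_lt_trans _ s2r)//.
  by rewrite -[leRHS]lnK ?posrE// ler_expR; lra.
move=> /(_ CR); rewrite /rect_integral add0r subrKC.
have per x : cexp x (2 * pi) = cexp x 0.
  by rewrite /cexp /expi cos0 sin0 mulr_natl cos2pi sin2pi.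
rewrite [X in X - _](_ : _ = \int[mu]_(s in `[ln s1, ln s2]) - Im (g (cexp s (2 * pi)))).
  rewrite subrr add0r => /eqP; rewrite subr_eq0 => /eqP.
  by rewrite /cexp !lnK.
by apply: eq_Rintegral => x _; rewrite per.
Qed.

(** The mean value property, for [g] holomorphic on a punctured disc with limit
    [c] at the centre: no derivative at the centre itself is needed. *)
Lemma circle_mean (c : R[i]) (s : R) :
  (forall e, 0 < e -> exists2 d : R, 0 < d &
     forall l, 0 < normc l < d -> normc (g l - c) < e) ->
  0 < s < r ->
  \int[mu]_(t in `[0, 2 * pi]) Re (g (s%:C * expi t)) = Re c * (2 * pi).
Proof.
move=> cg /andP[s0 sr].
have q0 : 0 <= 2 * pi :> R by rewrite mulr_ge0// pi_ge0.
apply/eqP; rewrite -subr_eq0 -normr_le0; apply/ler_addgt0Pr => e e0; rewrite add0r.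
have e1 : 0 < e / (2 * pi) by rewrite divr_gt0// mulr_gt0// pi_gt0.
have [d d0 H] := cg _ e1.
pose s1 := Num.min s (d / 2).
have s10 : 0 < s1 by rewrite lt_min s0 divr_gt0.
have s1s : s1 <= s by rewrite ge_min lexx.
have s1d : s1 < d by rewrite gt_min; apply/orP; right; lra.
rewrite -(circle_mean_cst s10 s1s sr).
have s1r : 0 < s1 < r by rewrite s10 (le_lt_trans s1s).
have := @Rintegral_itv_approx R (fun t => Re (g (s1%:C * expi t))) 0 (2 * pi) (Re c)
  (e / (2 * pi)) q0.
rewrite subr0 [e / _ * _]mulrVK ?unitfE ?mulf_neq0 ?gt_eqF ?pi_gt0//; apply.
  by move=> t _; exact: continuous_circle.
move=> t _; have n : 0 < normc (s1%:C * expi t) < d.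
  by rewrite normcM normc_expi mulr1 normcR gtr0_norm// s10.
apply/ltW; apply: le_lt_trans (H _ n); apply: le_trans (normr_Re_le _).
by case: (g _) (c) => [? ?] [? ?].
Qed.

End circle.
End mean_value_property.

(** * The Hermitian structure of [C^n] *)

Section hermitian.
Context {R : realType} {n : nat}.
Local Notation Re := (@complex.Re R).
Implicit Types (z w : 'rV[R[i]]_n).

(** The Hermitian inner product of [C^n], linear on the left. *)
Definition hdot z w : R[i] := \sum_(j < n) z 0 j * (w 0 j)^*.
(** The square of the Euclidean norm. *)
Definition sqn z : R := \sum_(j < n) normc (z 0 j) ^+ 2.

Lemma enormE z : enorm z = Num.sqrt (sqn z).
Proof. by rewrite /enorm /sqn; congr Num.sqrt; apply: eq_bigr => j _; rewrite sqr_normcE. Qed.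

Lemma sqn_ge0 z : 0 <= sqn z.
Proof. by apply: sumr_ge0 => j _; rewrite sqr_ge0. Qed.

Lemma enorm_ge0 z : 0 <= enorm z.
Proof. by rewrite sqrtr_ge0. Qed.

Lemma sqr_enorm z : enorm z ^+ 2 = sqn z.
Proof. by rewrite enormE sqr_sqrtr ?sqn_ge0. Qed.

Lemma sqn_hdot z : (sqn z)%:C = hdot z z.
Proof.
rewrite /sqn /hdot rmorph_sum/=; apply: eq_bigr => j _.
by rewrite -sqr_normc normr_normcE rmorphXn.
Qed.

Lemma sqn_eq0 z : sqn z = 0 -> z = 0.
Proof.
move=> /eqP; rewrite psumr_eq0 => [/allP H|j _]; last exact: sqr_ge0.
apply/rowP => j; rewrite mxE; apply: eq0_normc; apply/eqP.
by have := H j (mem_index_enum _); rewrite sqrf_eq0.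
Qed.

Lemma sqn0 : sqn 0 = 0.
Proof. by rewrite /sqn big1// => j _; rewrite mxE normc0 expr0n. Qed.

Lemma hdotDl z1 z2 w : hdot (z1 + z2) w = hdot z1 w + hdot z2 w.
Proof. by rewrite /hdot -big_split; apply: eq_bigr => j _; rewrite mxE mulrDl. Qed.

Lemma hdotZl a z w : hdot (a *: z) w = a * hdot z w.
Proof. by rewrite /hdot mulr_sumr; apply: eq_bigr => j _; rewrite mxE mulrA. Qed.

Lemma hdotNl z w : hdot (- z) w = - hdot z w.
Proof. by rewrite -scaleN1r hdotZl mulN1r. Qed.

Lemma sqnD z w : sqn (z + w) = sqn z + 2 * Re (hdot z w) + sqn w.
Proof.
rewrite /sqn /hdot raddf_sum/= mulr_sumr -!big_split/=; apply: eq_bigr => j _.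
by rewrite mxE !sqr_normcE; case: (z 0 j) (w 0 j) => [a b] [c d] /=; ring.
Qed.

Lemma sqnZ a z : sqn (a *: z) = normc a ^+ 2 * sqn z.
Proof. by rewrite /sqn mulr_sumr; apply: eq_bigr => j _; rewrite mxE normcM exprMn. Qed.

Lemma sqnN z : sqn (- z) = sqn z.
Proof. by rewrite -scaleN1r sqnZ normcN normc1 expr1n mul1r. Qed.

Lemma enormN z : enorm (- z) = enorm z.
Proof. by rewrite !enormE sqnN. Qed.

Lemma hdotZr a z w : hdot z (a *: w) = a^* * hdot z w.
Proof.
by rewrite /hdot mulr_sumr; apply: eq_bigr => j _; rewrite mxE rmorphM mulrCA.
Qed.

(** The Cauchy-Schwarz inequality. *)
Lemma hdot_sqr_le z w : normc (hdot z w) ^+ 2 <= sqn z * sqn w.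
Proof.
have [/sqn_eq0 ->|w0] := eqVneq (sqn w) 0.
  have -> : hdot z 0 = 0 by rewrite /hdot big1// => j _; rewrite mxE rmorph0 mulr0.
  by rewrite normc0 expr0n sqn0 mulr0.
have w1 : 0 < sqn w by rewrite lt_def w0 sqn_ge0.
set c := hdot z w; set s := sqn w in w0 w1 *.
(* expand the squared norm of the component of z orthogonal to w *)
have := sqn_ge0 (z + (- c * (s^-1)%:C) *: w).
rewrite sqnD sqnZ hdotZr -/c -/s.
have -> : Re ((- c * (s^-1)%:C)^* * c) = - (normc c ^+ 2 / s).
  by rewrite sqr_normcE; case: (c) => a b /=; ring.
have -> : normc (- c * (s^-1)%:C) ^+ 2 = normc c ^+ 2 / s ^+ 2.
  by rewrite normcM normcN normcR exprMn real_normK ?num_real// exprVn.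
have -> : normc c ^+ 2 / s ^+ 2 * s = normc c ^+ 2 / s by field.
rewrite -ler_pdivrMr//; lra.
Qed.

Lemma normc_hdot_le z w : normc (hdot z w) <= enorm z * enorm w.
Proof.
rewrite -(ler_pXn2r (ltn0Sn 1)) ?nnegrE ?normc_ge0 ?mulr_ge0 ?enorm_ge0//.
by rewrite exprMn !sqr_enorm hdot_sqr_le.
Qed.

Lemma enormD z w : enorm (z + w) <= enorm z + enorm w.
Proof.
rewrite -(ler_pXn2r (ltn0Sn 1)) ?nnegrE ?addr_ge0 ?enorm_ge0//.
have : Re (hdot z w) <= enorm z * enorm w.
  by apply: le_trans (normc_hdot_le z w); apply: le_trans (normr_Re_le _); rewrite ler_norm.
rewrite sqrrD !sqr_enorm sqnD; lra.
Qed.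

Lemma enormB z w : enorm (z - w) = enorm (w - z).
Proof. by rewrite -enormN opprB. Qed.

Lemma normc_le_enorm z j : normc (z 0 j) <= enorm z.
Proof.
rewrite -(ler_pXn2r (ltn0Sn 1)) ?nnegrE ?normc_ge0 ?enorm_ge0// sqr_enorm /sqn.
by rewrite (bigD1 j)//= lerDl sumr_ge0// => k _; rewrite sqr_ge0.
Qed.

Lemma enorm_le_sum z : enorm z <= \sum_(j < n) normc (z 0 j).
Proof.
rewrite -(ler_pXn2r (ltn0Sn 1)) ?nnegrE ?enorm_ge0 ?sumr_ge0//; last first.
  by move=> j _; exact: normc_ge0.
rewrite sqr_enorm /sqn expr2 mulr_suml; apply: ler_sum => j _.
rewrite expr2 ler_wpM2l ?normc_ge0// (bigD1 j)//= lerDl sumr_ge0// => k _.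
exact: normc_ge0.
Qed.

(** The balls of the Euclidean norm define the topology of [C^n]. *)
Lemma nbhs_enormP z (P : set 'rV[R[i]]_n) :
  nbhs z P <-> exists2 d : R, 0 < d & forall w, enorm (w - z) < d -> P w.
Proof.
split.
  move=> /nbhs_ballP[e /= e0 eP]; exists (Re e).
    by move: e0; rewrite ltcE => /andP[].
  move=> w zw; apply: eP; split => // i j; rewrite ord1.
  rewrite -ball_normE /ball_ /= -(RRe_real (gtr0_real e0)) normr_normcE ltcR normcB.
  by apply: le_lt_trans zw; have := normc_le_enorm (w - z) j; rewrite !mxE.
move=> [d d0 dP].
have e0 : 0 < d / (n.+1)%:R by rewrite divr_gt0.
apply/nbhs_ballP; exists (d / (n.+1)%:R)%:C; first by rewrite /= ltcR.
move=> w [_ H]; apply: dP; apply: le_lt_trans (enorm_le_sum _) _.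
apply: (@le_lt_trans _ _ (\sum_(j < n) (d / (n.+1)%:R))).
  apply: ler_sum => j _; have := H 0 j.
  by rewrite -ball_normE /ball_ /= normr_normcE ltcR normcB !mxE => /ltW.
rewrite sumr_const card_ord -[_ *+ n]mulr_natr mulrAC ltr_pdivrMr// ltr_pM2l// ltr_nat.
exact: ltnSn.
Qed.

Lemma continuous_enormP {T : topologicalType} (F : T -> 'rV[R[i]]_n) x :
  (forall e : R, 0 < e -> \forall y \near x, enorm (F y - F x) < e) ->
  {for x, continuous F}.
Proof.
move=> H P /nbhs_enormP[d d0 dP]; apply: filterS (H d d0) => y; exact: dP.
Qed.

Lemma continuous_enorm : continuous (@enorm R n).
Proof.
move=> z; apply/(@cvgrPdist_lt _ _ _ (nbhs z) _) => e e0; apply/nbhs_enormP; exists e => // h hz.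
apply: le_lt_trans hz.
have H1 := enormD (z - h) h; have H2 := enormD (h - z) z.
rewrite !subrK in H1 H2; rewrite ler_norml.
by rewrite (enormB z h) in H1; apply/andP; split; lra.
Qed.

End hermitian.

(** * Holomorphic minorants *)

Section littleo.
Context {R : realType}.
Local Notation Re := (@complex.Re R).

Lemma near0_near (P : set R[i]) (l : R[i]) :
  (\forall h \near (0 : R[i]), P h) -> \forall z \near l, P (z - l).
Proof.
by move=> /nbhs0_normcP[d d0 dP]; apply/nbhs_normcP; exists d => // h; exact: dP.
Qed.

Lemma near_normc_lt (l : R[i]) (d : R) : 0 < d -> \forall z \near l, normc (z - l) < d.
Proof. by move=> d0; apply/nbhs_normcP; exists d. Qed.

Lemma derivable_lipschitz (f : R[i] -> R[i]) l : derivable f l 1 ->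
  exists2 C : R, 0 < C & \forall z \near l, normc (f z - f l) <= C * normc (z - l).
Proof.
move=> df; exists (normc ('D_1 f l) + 1); first by rewrite ltr_wpDl// normc_ge0.
have := near0_near l (derivable_littleo df ltr01).
apply: filterS => z /=; rewrite subrKC mul1r => H.
have -> : f z - f l = (f z - f l - (z - l) * 'D_1 f l) + (z - l) * 'D_1 f l by rewrite subrK.
rewrite (le_trans (normcD _ _))// [leRHS]mulrDl mul1r addrC lerD//.
by rewrite normcM mulrC.
Qed.

Context {n : nat}.
Implicit Types (F : R[i] -> 'rV[R[i]]_n) (l : R[i]).

Lemma enormZ a (z : 'rV[R[i]]_n) : enorm (a *: z) = normc a * enorm z.
Proof.
by rewrite !enormE sqnZ sqrtrM ?sqr_ge0// sqrtr_sqr ger0_norm// normc_ge0.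
Qed.

Lemma derivable_littleo_enorm F l : derivable F l 1 -> forall e : R, 0 < e ->
  \forall z \near l, enorm (F z - F l - (z - l) *: 'D_1 F l) <= e * normc (z - l).
Proof.
move=> dF e e0; set a := 'D_1 F l.
have H : (fun h => h^-1 *: ((F \o shift l) (h *: (1 : R[i])) - F l)) @ 0^' --> a by [].
have N : nbhs a [set w | enorm (w - a) < e] by apply/nbhs_enormP; exists e.
have {H N} := H _ N; rewrite /= /dnbhs /within /= => /nbhs0_normcP[d d0 dP].
apply/nbhs_normcP; exists d => // z zd.
have [->|zl] := eqVneq z l.
  by rewrite !subrr scale0r subrr normc0 mulr0 /enorm big1 ?sqrtr0// => j _; rewrite mxE/= expr0n addr0.
have h0 : z - l != 0 by rewrite subr_eq0.
have := dP _ zd h0; rewrite /= [X in F (X + l)](_ : _ = z - l); last exact: mulr1.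
rewrite subrK => H1.
have -> : F z - F l - (z - l) *: a = (z - l) *: ((z - l)^-1 *: (F z - F l) - a).
  by rewrite scalerBr scalerA mulfV// scale1r.
by rewrite enormZ mulrC ler_wpM2r ?normc_ge0// ltW.
Qed.

Lemma derivable_continuous_rV F l : derivable F l 1 -> {for l, continuous F}.
Proof. by move=> /derivable1_diffP H; exact: differentiable_continuous. Qed.

Lemma derivable_hdot F l w : derivable F l 1 -> derivable (fun z => hdot (F z) w) l 1.
Proof.
move=> dF; rewrite /hdot; elim: (index_enum _) => [|j s IH].
  rewrite (_ : (fun _ => _) = fun=> 0); first exact: derivable_cstc.
  by apply/funext => z; rewrite big_nil.
rewrite (_ : (fun _ => _) = fun z => F z 0 j * (w 0 j)^* + \sum_(i <- s) F z 0 i * (w 0 i)^*).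
  apply: derivable_addc IH; apply: derivable_mulc; last exact: derivable_cstc.
  exact: (derivable_coord j dF).1.
by apply/funext => z; rewrite big_cons.
Qed.

End littleo.

Section supports.
Context {R : realType}.
Local Notation Re := (@complex.Re R).
Implicit Types (T : R[i] -> R) (l : R[i]) (s : R).

(** [T] is bounded below near [l], with equality at [l], by the sum of a
    constant, the real part of a holomorphic function and [s |z - l|^2]; for a
    function of class [C^2] this bounds its Laplacian at [l] from below by
    [4 s]. *)
Definition supported T l s := exists q : R[i] -> R[i],
  [/\ q l = 0, \forall z \near l, derivable q z 1 &
      \forall z \near l, T l + Re (q z) + s * normc (z - l) ^+ 2 <= T z].

Lemma supportedD T1 T2 l s1 s2 : supported T1 l s1 -> supported T2 l s2 ->
  supported (fun z => T1 z + T2 z) l (s1 + s2).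
Proof.
move=> [q1 [q10 dq1 H1]] [q2 [q20 dq2 H2]]; exists (fun z => q1 z + q2 z); split.
- by rewrite q10 q20 addr0.
- by apply: filterS2 dq1 dq2 => z; exact: derivable_addc.
- near=> z.
  have : T1 l + Re (q1 z) + s1 * normc (z - l) ^+ 2 <= T1 z by near: z.
  have : T2 l + Re (q2 z) + s2 * normc (z - l) ^+ 2 <= T2 z by near: z.
  by rewrite raddfD/= mulrDl; lra.
Unshelve. all: by end_near. Qed.

Lemma supportedZ a T l s : 0 <= a -> supported T l s ->
  supported (fun z => a * T z) l (a * s).
Proof.
move=> a0 [q [q0 dq H]]; exists (fun z => a%:C * q z); split.
- by rewrite q0 mulr0.
- by apply: filterS dq => z; apply: derivable_mulc; exact: derivable_cstc.
- near=> z.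
  have : T l + Re (q z) + s * normc (z - l) ^+ 2 <= T z by near: z.
  move=> /(ler_wpM2l a0); apply: le_trans.
  have -> : Re (a%:C * q z) = a * Re (q z) by case: (q z) => ? ? /=; ring.
  by rewrite le_eqVlt; apply/orP; left; apply/eqP; ring.
Unshelve. all: by end_near. Qed.

Lemma supportedDr T l s (c : R) : supported T l s -> supported (fun z => T z + c) l s.
Proof.
move=> [q [q0 dq H]]; exists q; split => //.
by apply: filterS H => z /=; lra.
Qed.

Lemma supported_ge T1 T2 l s : T1 l = T2 l -> (\forall z \near l, T1 z <= T2 z) ->
  supported T1 l s -> supported T2 l s.
Proof.
move=> T12 H12 [q [q0 dq H]]; exists q; split => //.
near=> z; rewrite -T12.
have : T1 l + Re (q z) + s * normc (z - l) ^+ 2 <= T1 z by near: z.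
by move=> /le_trans; apply; near: z.
Unshelve. all: by end_near. Qed.

Lemma supported_sqr_normc l : supported (fun z => normc z ^+ 2) l 1.
Proof.
exists (fun z => (z + - l) * (2 * l^*)); split.
- by rewrite subrr mul0r.
- apply: (@filterE _ (nbhs l)) => z; apply: derivable_mulc; last exact: derivable_cstc.
  by apply: derivable_addc; [exact: derivable_idc|exact: derivable_cstc].
- near=> z; rewrite mul1r !sqr_normcE.
  by case: (z) (l) => [a b] [c d] /=; rewrite le_eqVlt; apply/orP; left; apply/eqP; ring.
Unshelve. all: by end_near. Qed.

(** Taylor lower bound of order 2; the function [ln t + t^2 / 2 - 2 t] has
    derivative [(t - 1)^2 / t]. *)
Lemma ln1D_ge (x : R) : `|x| <= 1 / 2 -> x - x ^+ 2 / 2 - 2 * `|x| ^+ 3 <= ln (1 + x).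
Proof.
move=> x12; pose f : R -> R := @ln R + ((1 / 2) \*: (id ^+ 2) - 2 \*: id).
pose df (t : R) : R := (t - 1) ^+ 2 / t.
have Df (t : R) : 0 < t -> is_derive t 1 f (df t).
  move=> t0; have Dln := is_derive1_ln t0.
  have Did := is_derive_id t (1 : R).
  have D := is_deriveD Dln (is_deriveB (is_deriveZ (1 / 2) (is_deriveX 2 Did)) (is_deriveZ 2 Did)).
  apply: (is_derive_eq D); rewrite /df /= expr1 /GRing.scale/=; field.
  by rewrite gt_eqF.
have fE (t : R) : f t = ln t + (1 / 2 * t ^+ 2 - 2 * t) by [].
have cf (a b : R) : 0 < a -> {within `[a, b], continuous f}.
  move=> a0; apply: derivable_within_continuous => t; rewrite in_itv/= => /andP[ta _].
  by have [] := Df t (lt_le_trans a0 ta).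
move: x12; rewrite ler_norml => /andP[x1 x2].
have [x0|x0] := leP 0 x.
  have x1' : 1 <= 1 + x by lra.
  have D1 y : y \in `]1, 1 + x[%R -> is_derive y 1 f (df y).
    by rewrite in_itv/= => /andP[? _]; apply: Df; lra.
  have [c] := MVT_segment x1' D1 (cf 1 (1 + x) ltr01).
  rewrite in_itv/= !fE ln1 /df => /andP[c1 c2] E.
  have : 0 <= (c - 1) ^+ 2 / c * (1 + x - 1).
    by rewrite mulr_ge0 ?divr_ge0 ?sqr_ge0//; lra.
  have : 0 <= `|x| ^+ 3 by rewrite exprn_ge0.
  rewrite -E; lra.
have x1' : 1 + x <= 1 by lra.
have x1p : 0 < 1 + x by lra.
have D1 y : y \in `]1 + x, 1[%R -> is_derive y 1 f (df y).
  by rewrite in_itv/= => /andP[? _]; apply: Df; lra.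
have [c] := MVT_segment x1' D1 (cf (1 + x) 1 x1p).
rewrite in_itv/= !fE ln1 /df => /andP[c1 c2] E.
have c0 : 0 < c by lra.
have : (c - 1) ^+ 2 / c * (1 - (1 + x)) <= 2 * `|x| ^+ 3.
  have -> : 2 * `|x| ^+ 3 = 2 * x ^+ 2 * (1 - (1 + x)).
    by rewrite ltr0_norm//; ring.
  rewrite ler_wpM2r//; first by lra.
  rewrite ler_pdivrMr//.
  have B1 : (c - 1) ^+ 2 <= x ^+ 2.
    rewrite -[leLHS]sqrrN -[leRHS]sqrrN lerXn2r// ?nnegrE; lra.
  have B2 : 0 <= x ^+ 2 * (2 * c - 1) by rewrite mulr_ge0 ?sqr_ge0//; lra.
  lra.
rewrite -E; lra.
Qed.

(** To second order [ln |1 + z|^2] is the real part of the polynomial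
    [2 z - z^2], without recourse to a complex logarithm. *)
Lemma ln_sqr_normc1D_ge (e : R) : 0 < e -> exists2 d : R, 0 < d & forall z : R[i],
  normc z < d -> 0 < normc (1 + z) /\
    Re (2 * z - z * z) - e * normc z ^+ 2 <= ln (normc (1 + z) ^+ 2).
Proof.
move=> e0; exists (Num.min (1 / 6) (e / 60)); first by rewrite lt_min !divr_gt0.
move=> z; rewrite lt_min => /andP[z1 z2].
have z0 := normc_ge0 z.
have N : normc (1 + z) ^+ 2 = 1 + (2 * Re z + normc z ^+ 2).
  by rewrite !sqr_normcE; case: (z) => a b /=; ring.
have zz : normc z ^+ 2 <= normc z / 6.
  by rewrite expr2 ler_wpM2l//; lra.
have rz := normr_Re_le z.
set x := 2 * Re z + normc z ^+ 2 in N.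
have xz : `|x| <= 3 * normc z.
  have /andP[r1 r2] : - normc z <= Re z <= normc z by rewrite -ler_norml.
  have n2 := sqr_ge0 (normc z).
  by rewrite /x ler_norml; apply/andP; split; lra.
have x12 : `|x| <= 1 / 2 by lra.
split.
  rewrite -(ltr_pXn2r (ltn0Sn 1)) ?nnegrE ?normc_ge0// expr0n N /=.
  by move: x12; rewrite ler_norml => /andP[? _]; lra.
rewrite N; apply: le_trans (ln1D_ge x12).
have -> : Re (2 * z - z * z) = x - 2 * Re z ^+ 2.
  by rewrite /x sqr_normcE; case: (z) => a b /=; ring.
have x3 : `|x| ^+ 3 <= 27 * normc z ^+ 3.
  have -> : 27 * normc z ^+ 3 = (3 * normc z) ^+ 3 by ring.
  by rewrite lerXn2r// nnegrE mulr_ge0.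
have E3 : normc z ^+ 3 <= normc z ^+ 2 * (e / 60).
  by rewrite exprSr ler_wpM2l ?sqr_ge0// ltW.
have n3 : 0 <= normc z ^+ 3 by rewrite exprn_ge0.
have x2 : x ^+ 2 / 2 <= 2 * Re z ^+ 2 + 3 * normc z ^+ 3.
  have -> : x ^+ 2 / 2 = 2 * Re z ^+ 2 + (2 * Re z * normc z ^+ 2 + normc z ^+ 4 / 2).
    by rewrite /x; field.
  have A1 : Re z * normc z ^+ 2 <= normc z ^+ 3.
    rewrite [leRHS]exprS ler_wpM2r ?sqr_ge0//; exact: le_trans (ler_norm _) rz.
  have A2 : normc z ^+ 4 <= normc z ^+ 3 by rewrite exprS ler_piMl//; lra.
  lra.
lra.
Qed.

Lemma supported_ln_normc (G : R[i] -> R[i]) l (e : R) : 0 < e ->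
  (\forall z \near l, derivable G z 1) -> G l != 0 ->
  supported (fun z => ln (normc (G z) ^+ 2)) l (- e).
Proof.
move=> e0 dG Gl0; pose k z := (G z - G l) * (G l)^-1.
have dGl : derivable G l 1 by exact: nbhs_singleton dG.
have [C C0 HC] := derivable_lipschitz dGl.
have Gl1 : 0 < normc (G l).
  by rewrite lt_def normc_ge0 andbT; apply: contra_neq Gl0 => /eq0_normc.
pose C' := C / normc (G l).
have C'0 : 0 < C' by rewrite divr_gt0.
have e1 : 0 < e / C' ^+ 2 by rewrite divr_gt0// exprn_gt0.
have [d d0 Hd] := ln_sqr_normc1D_ge e1.
have kC : \forall z \near l, normc (k z) <= C' * normc (z - l).
  apply: filterS HC => z Hz; rewrite /k normcM normcV /C' mulrAC.
  by rewrite ler_wpM2r// invr_ge0 ltW.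
exists (fun z => 2 * k z + - (k z * k z)); split.
- by rewrite /k subrr mul0r !mulr0 oppr0 addr0.
- apply: filterS dG => z dGz; have dk : derivable k z 1.
    apply: derivable_mulc; last exact: derivable_cstc.
    exact: (derivable_addc dGz (@derivable_cstc R (- G l) z)).
  apply: derivable_addc; first by apply: derivable_mulc dk; exact: derivable_cstc.
  rewrite (_ : (fun _ => _) = fun x => (-1) * (k x * k x)); last by apply/funext => x; rewrite mulN1r.
  by apply: derivable_mulc; [exact: derivable_cstc|exact: derivable_mulc].
- near=> z.
  have kz : normc (k z) <= C' * normc (z - l) by near: z.
  have zd : normc (z - l) < d / C' by near: z; apply: near_normc_lt; rewrite divr_gt0.
  have kd : normc (k z) < d by apply: le_lt_trans kz _; rewrite mulrC -ltr_pdivlMr.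
  have [k0 Hk] := Hd _ kd.
  have -> : G z = G l * (1 + k z) by rewrite /k; field.
  rewrite normcM exprMn [leRHS]lnM ?posrE ?exprn_gt0//.
  have B : e / C' ^+ 2 * normc (k z) ^+ 2 <= e * normc (z - l) ^+ 2.
    have -> : e * normc (z - l) ^+ 2 = e / C' ^+ 2 * (C' * normc (z - l)) ^+ 2.
      by field; rewrite gt_eqF.
    rewrite ler_wpM2l ?(ltW e1)// lerXn2r// nnegrE ?normc_ge0//.
    by rewrite mulr_ge0 ?normc_ge0// ltW.
  by move: Hk B; lra.
Unshelve. all: by end_near. Qed.

Lemma supported_lnVnormc l (e : R) : 0 < e -> l != 0 ->
  supported (fun z => - ln (normc z)) l (- e).
Proof.
move=> e0 l0.
have l1 : 0 < normc l.
  by rewrite lt_def normc_ge0 andbT; apply: contra_neq l0 => /eq0_normc.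
have near0 : \forall z \near l, z != 0.
  apply: filterS (near_normc_lt l l1) => z; apply: contraPneq => ->.
  by rewrite sub0r normcN ltxx.
have half0 : 0 <= 1 / 2 :> R by rewrite divr_ge0.
have -> : - e = 1 / 2 * (- (2 * e)) by field.
have dV : \forall z \near l, derivable (fun z : R[i] => z^-1) z 1.
  by apply: filterS near0 => z z0; exact: (@derivable_invc R (fun x => x) z (@derivable_idc R z) z0).
have e2 : 0 < 2 * e by rewrite mulr_gt0.
have Vl0 : l^-1 != 0 by rewrite invr_eq0.
have := supportedZ half0 (@supported_ln_normc (fun z => z^-1) l _ e2 dV Vl0).
have E z : z != 0 -> 1 / 2 * ln (normc z^-1 ^+ 2) = - ln (normc z).
  move=> z0; have z1 : 0 < normc z.
    by rewrite lt_def normc_ge0 andbT; apply: contra_neq z0 => /eq0_normc.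
  by rewrite normcV lnXn ?invr_gt0// lnV ?posrE//; lra.
apply: supported_ge; first exact: E.
by apply: filterS near0 => z /E ->.
Unshelve. all: by end_near. Qed.

Context {n : nat}.
Implicit Types F : R[i] -> 'rV[R[i]]_n.

Lemma supported_sqn F l : (\forall z \near l, derivable F z 1) ->
  supported (fun z => sqn (F z)) l 0.
Proof.
move=> dF; exists (fun z => (hdot (F z) (F l) + - hdot (F l) (F l)) * 2); split.
- by rewrite subrr mul0r.
- apply: filterS dF => z dFz; apply: derivable_mulc; last exact: derivable_cstc.
  exact: (derivable_addc (@derivable_hdot R n F z (F l) dFz) (@derivable_cstc R (- hdot (F l) (F l)) z)).
- near=> z; rewrite mul0r addr0.
  have -> : F z = F l + (F z - F l) by rewrite subrKC.
  have HE : hdot (F l + (F z - F l)) (F l) - hdot (F l) (F l) = hdot (F z - F l) (F l).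
    by rewrite hdotDl addrAC subrr add0r.
  rewrite HE [F l + _]addrC sqnD.
  have -> : Re (hdot (F z - F l) (F l) * 2) = 2 * Re (hdot (F z - F l) (F l)).
    by case: (hdot _ _) => ? ? /=; ring.
  by have := sqn_ge0 (F z - F l); lra.
Unshelve. all: by end_near. Qed.

(** [ln |F|^2] is bounded below by [ln |<F, F l>|^2], up to a constant that
    makes both equal at [l], and [<F, F l>] is a scalar holomorphic function. *)
Lemma supported_ln_sqn F l (e : R) : 0 < e -> (\forall z \near l, derivable F z 1) ->
  F l != 0 -> supported (fun z => ln (sqn (F z))) l (- e).
Proof.
move=> e0 dF Fl0.
have Fl1 : 0 < sqn (F l).
  by rewrite lt_def sqn_ge0 andbT; apply: contra_neq Fl0 => /sqn_eq0.
pose G z := hdot (F z) (F l).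
have dG : \forall z \near l, derivable G z 1.
  by apply: filterS dF => z; exact: derivable_hdot.
have Gl : G l = (sqn (F l))%:C by rewrite /G sqn_hdot.
have nGl : normc (G l) = sqn (F l) by rewrite Gl normcR gtr0_norm.
have Gl0 : G l != 0.
  by apply: contraTneq Fl1 => Gl0; rewrite -nGl Gl0 normc0 ltxx.
have cG := derivable_continuousc (nbhs_singleton dG).
have G0 : \forall z \near l, 0 < normc (G z).
  have n0 : 0 < normc (G l) by rewrite nGl.
  apply: filterS (continuous_normcE cG n0) => z H.
  have := normcD (G z) (G l - G z); rewrite subrKC normcB; lra.
have := supportedDr (- ln (sqn (F l))) (supported_ln_normc e0 dG Gl0).
apply: supported_ge.
  by rewrite nGl lnXn// mulr2n addrK.
near=> z.
have Gz : 0 < normc (G z) by near: z.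
have CS : normc (G z) ^+ 2 <= sqn (F z) * sqn (F l) by exact: hdot_sqr_le.
have Fz : 0 < sqn (F z) by rewrite -(pmulr_lgt0 _ Fl1) (lt_le_trans _ CS)// exprn_gt0.
by rewrite lerBlDr -lnM// ler_ln ?posrE ?exprn_gt0// mulr_gt0.
Unshelve. all: by end_near. Qed.

End supports.

(** * Plurisubharmonic functions along holomorphic discs *)

Section plurisubharmonic_contact.
Context {R : realType} {n : nat}.
Notation mu := (@lebesgue_measure R).
Local Notation Re := (@complex.Re R).
Variables (Omega : set 'rV[R[i]]_n) (phi : 'rV[R[i]]_n -> R).
Hypotheses (oOmega : open Omega) (cphi : {within Omega, continuous phi})
  (pphi : plurisubharmonic Omega phi).

Lemma continuous_at_Omega x : Omega x -> {for x, continuous phi}.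
Proof.
move=> Ox; have := cphi; rewrite continuous_open_subspace// => /(_ x).
by apply; rewrite inE.
Qed.

Lemma continuous_circle_rV (x v : 'rV[R[i]]_n) (r : R) :
  continuous (fun t : R => x + (0 + r%:C * expi t) *: v).
Proof.
move=> t; apply: continuous_enormP => e e0.
have M0 : 0 < `|r| * enorm v + 1 by rewrite ltr_wpDl// mulr_ge0// enorm_ge0.
have := continuous_normcE (@continuous_expi R t) (divr_gt0 e0 M0).
apply: filterS => y H.
have -> : x + (0 + r%:C * expi y) *: v - (x + (0 + r%:C * expi t) *: v) =
    (r%:C * (expi y - expi t)) *: v.
  by rewrite opprD addrACA subrr add0r -scalerBl !add0r mulrBr.
rewrite enormZ normcM normcR.
rewrite ltr_pdivlMr// in H; apply: le_lt_trans H.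
rewrite mulrAC mulrC ler_wpM2l ?normc_ge0//.
by rewrite lerDl.
Qed.

(** If [T] has positive Laplacian at [l] then [phi + T] has no local maximum at
    [l] along a complex line: integrate over a small circle, where the
    holomorphic part of [T] has mean zero. *)
Lemma psh_contact (x v : 'rV[R[i]]_n) (l : R[i]) (T : R[i] -> R) (s : R) :
  Omega x -> 0 < s -> supported T l s ->
  (\forall z \near l, phi (x + (z - l) *: v) + T z <= phi x + T l) -> False.
Proof.
move=> Ox s0 [q [ql dq qT]] H.
have cline : {for l, continuous (fun z : R[i] => x + (z - l) *: v)}.
  apply: continuous_enormP => e e0.
  have M0 : 0 < enorm v + 1 by rewrite ltr_wpDl// enorm_ge0.
  have := near_normc_lt l (divr_gt0 e0 M0).
  apply: filterS => z; rewrite ltr_pdivlMr// => zM.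
  rewrite subrr scale0r addr0 [X in enorm X](_ : _ = (z - l) *: v); last by rewrite addrAC subrr add0r.
  by rewrite enormZ; apply: le_lt_trans zM; rewrite ler_wpM2l ?normc_ge0// lerDl.
have Oline : \forall z \near l, Omega (x + (z - l) *: v).
  apply: cline; rewrite /= subrr scale0r addr0; exact: open_nbhs_nbhs.
have /nbhs_normcP[d d0 {H}Hd] : \forall z \near l, [/\ derivable q z 1,
    phi (x + (z - l) *: v) <= phi x - s * normc (z - l) ^+ 2 - Re (q z) &
    Omega (x + (z - l) *: v)].
  have B : \forall z \near l,
      phi (x + (z - l) *: v) <= phi x - s * normc (z - l) ^+ 2 - Re (q z).
    by apply: filterS2 H qT => z /= A1 A2; lra.
  by apply: filterS3 dq B Oline => z.
pose r := d / 2.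
have r0 : 0 < r by rewrite divr_gt0.
have rd : r < d by rewrite /r; lra.
have Hd' h : normc h < d -> [/\ derivable q (l + h) 1,
    phi (x + h *: v) <= phi x - s * normc h ^+ 2 - Re (q (l + h)) & Omega (x + h *: v)].
  by move=> hd; have := Hd (l + h); rewrite [l + h]addrC addrK [h + l]addrC => /(_ hd).
pose g h := q (l + h).
have dg h : 0 < normc h < d -> derivable g h 1.
  move=> /andP[_ /Hd'[D _ _]].
  apply/cvg_ex; exists ('D_1 q (l + h)).
  have : (fun k => k^-1 *: ((q \o shift (l + h)) (k *: (1 : R[i])) - q (l + h)))
    @ 0^' --> 'D_1 q (l + h) by [].
  suff -> : (fun k => k^-1 *: ((q \o shift (l + h)) (k *: (1 : R[i])) - q (l + h))) =
    (fun k => k^-1 *: ((g \o shift h) (k *: (1 : R[i])) - g h)) by [].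
  by apply/funext => k; rewrite /g /= addrCA.
have g0 : forall e, 0 < e -> exists2 c : R, 0 < c & forall k, 0 < normc k < c -> normc (g k - 0) < e.
  move=> e e0; have dql := nbhs_singleton dq.
  have /nbhs_normcP[c c0 Hc] := continuous_normcE (derivable_continuousc dql) e0.
  exists c => // k /andP[_ kc]; have := Hc (l + k); rewrite [l + k]addrC addrK ql /g [k + l]addrC.
  by apply.
have rrd : 0 < r < d by rewrite r0.
have mean0 := circle_mean dg g0 rrd.
rewrite mul0r in mean0.
have nr t : normc (r%:C * expi t) = r by rewrite normcM normc_expi mulr1 normcR gtr0_norm.
have [_ /(_ x v)[_ /(_ 0 r r0)]] := pphi.
rewrite scale0r addr0 => Hsub.
have {Hsub} Hsub : ((phi x)%:E <= ((2 * pi)^-1)%R%:E *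
    \int[mu]_(t in `[0%R, (2 * pi)%R]) (phi (x + (0 + r%:C * expi t) *: v)%R)%:E)%E.
  apply: Hsub => w; rewrite subr0 normr_normcE lecR => wr.
  by have [] := Hd' w (le_lt_trans wr rd).
pose u t := phi (x + (0 + r%:C * expi t) *: v).
have pi20 : 0 < 2 * pi :> R by rewrite mulr_gt0// pi_gt0.
have cu t : {for t, continuous u}.
  apply: (@continuous_comp _ _ _ (fun t : R => x + (0 + r%:C * expi t) *: v) phi).
    exact: continuous_circle_rV.
  apply: continuous_at_Omega; rewrite add0r; have [//|] := Hd' (r%:C * expi t); rewrite nr//.
have cg t : {for t, continuous (fun t => Re (g (r%:C * expi t)))}.
  exact: (continuous_circle dg rrd).
have iu : mu.-integrable `[0, 2 * pi] (EFin \o u).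
  by apply: continuous_itv_integrable => t _; exact: cu.
have ig : mu.-integrable `[0, 2 * pi] (EFin \o (fun t => Re (g (r%:C * expi t)))).
  by apply: continuous_itv_integrable => t _; exact: cg.
have ic : mu.-integrable `[0, 2 * pi] (EFin \o (fun=> phi x - s * r ^+ 2)).
  by apply: continuous_itv_integrable => t _; exact: cst_continuous.
have : \int[mu]_(t in `[0, 2 * pi]) u t <=
    \int[mu]_(t in `[0, 2 * pi]) (phi x - s * r ^+ 2 - Re (g (r%:C * expi t))).
  apply: le_Rintegral => //.
    apply: continuous_itv_integrable => t _.
    by apply: continuousB; [exact: cst_continuous|exact: cg].
  move=> t _; rewrite /u add0r; have [//|_ + _] := Hd' (r%:C * expi t); rewrite nr//.
rewrite RintegralB// mean0 subr0.
have := @Rintegral_itv_approx R (fun=> phi x - s * r ^+ 2) 0 (2 * pi) (phi x - s * r ^+ 2) 0 (ltW pi20).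
rewrite mul0r subr0 subrr normr0 => HI.
have {}HI := HI (fun t _ => @cst_continuous _ _ _ _) (fun t _ => lexx 0).
move: HI; rewrite normr_le0 subr_eq0 => /eqP -> Hle.
have iE : (\int[mu]_(t in `[0%R, (2 * pi)%R]) (phi (x + (0 + r%:C * expi t) *: v)%R)%:E)%E
    = (\int[mu]_(t in `[0%R, (2 * pi)%R]) u t)%:E.
  by rewrite /Rintegral fineK//; exact: integrable_fin_num.
move: Hsub; rewrite iE -EFinM lee_fin ler_pdivlMl// mulrC => /le_trans /(_ Hle).
rewrite ler_pM2r//.
have : 0 < s * r ^+ 2 by rewrite mulr_gt0// exprn_gt0.
lra.
Qed.

(** The same along a holomorphic disc [F]. The function of [(z, w)] obtained by
    adding to the disc an independent translation [w] is restricted to the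
    curve on which [F z + w] runs through a complex line; there [w] is
    holomorphic in [z] and stationary to first order. *)
Lemma psh_disc_contact (F : R[i] -> 'rV[R[i]]_n) (l : R[i]) (w : 'rV[R[i]]_n)
    (T : R[i] -> R) (A K s : R) :
  (\forall z \near l, derivable F z 1) -> Omega (F l + w) ->
  0 < A -> 0 <= K -> 0 < s -> supported T l s ->
  (exists2 d : R, 0 < d & forall z y, normc (z - l) < d -> enorm (y - w) < d ->
     A * phi (F z + y) - K * sqn y + T z <= A * phi (F l + w) - K * sqn w + T l) ->
  False.
Proof.
move=> dF OFl A0 K0 s0 sT [d d0 Hd].
have dFl := nbhs_singleton dF.
set v := 'D_1 F l.
pose e z := F z - F l - (z - l) *: v.
have el : e l = 0 by rewrite /e !subrr scale0r subr0.
pose y z := - e z + w.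
have yl : y l = w by rewrite /y el oppr0 add0r.
(* e is o(z - l); with this rate, K |e|^2 costs at most s / 2 |z - l|^2 *)
pose c := Num.min 1 (s / (2 * (K + 1))).
have c0 : 0 < c by rewrite lt_min ltr01 divr_gt0// mulr_gt0// ltr_wpDl.
have Kc : K * c ^+ 2 <= s / 2.
  have c1 : c <= 1 by rewrite ge_min lexx.
  have cK : c * (2 * (K + 1)) <= s.
    by rewrite -ler_pdivlMr ?mulr_gt0 ?ltr_wpDl// ge_min lexx orbT.
  have : K * c ^+ 2 <= K * c by rewrite ler_wpM2l// expr2 ler_piMl// ltW.
  by lra.
have He := derivable_littleo_enorm dFl c0.
have sy : supported (fun z => - (K * sqn (y z))) l (- (s / 2)).
  exists (fun z => (2 * K)%:C * (hdot (F z) w + - hdot (F l) w + (z + - l) * - hdot v w)); split.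
  - by rewrite !subrr mul0r addr0 mulr0.
  - apply: filterS dF => z dFz.
    apply: derivable_mulc; first exact: derivable_cstc.
    apply: derivable_addc.
      exact: (derivable_addc (@derivable_hdot R n F z w dFz) (@derivable_cstc R (- hdot (F l) w) z)).
    apply: derivable_mulc; last exact: derivable_cstc.
    exact: (derivable_addc (@derivable_idc R z) (@derivable_cstc R (- l) z)).
  - apply: filterS He => z; rewrite -/v -/(e z) => ez.
    have -> : hdot (F z) w + - hdot (F l) w + (z + - l) * - hdot v w = hdot (e z) w.
      by rewrite /e !hdotDl !hdotNl hdotZl; ring.
    rewrite yl /y sqnD sqnN.
    have -> : Re ((2 * K)%:C * hdot (e z) w) = 2 * K * Re (hdot (e z) w).
      by case: (hdot _ _) => ? ? /=; ring.
    have -> : Re (hdot (- e z) w) = - Re (hdot (e z) w).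
      by rewrite hdotNl; case: (hdot _ _).
    have : K * sqn (e z) <= s / 2 * normc (z - l) ^+ 2.
      apply: le_trans (_ : K * (c ^+ 2 * normc (z - l) ^+ 2) <= _).
        rewrite ler_wpM2l// -sqr_enorm -exprMn lerXn2r// ?nnegrE ?enorm_ge0//.
        by rewrite mulr_ge0 ?normc_ge0// ltW.
      by rewrite mulrA ler_wpM2r// sqr_ge0.
    lra.
have s2 : 0 < A^-1 * (s + - (s / 2)) by rewrite mulr_gt0 ?invr_gt0//; lra.
have Ai : 0 <= A^-1 by rewrite invr_ge0 ltW.
apply: (@psh_contact (F l + w) v l _ _ OFl s2 (supportedZ Ai (supportedD sT sy))).
have cy : \forall z \near l, enorm (y z - w) < d.
  have dc : 0 < d / c by rewrite divr_gt0.
  apply: filterS2 He (near_normc_lt l dc) => z ez zd.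
  rewrite /y addrK enormN; apply: le_lt_trans ez _.
  by rewrite mulrC -ltr_pdivlMr.
apply: filterS2 cy (near_normc_lt l d0) => z yz zd.
have := Hd z (y z) zd yz.
have -> : F z + y z = F l + w + (z - l) *: v.
  by rewrite /y /e; apply/rowP => j; rewrite !mxE; ring.
rewrite yl => H.
rewrite -(ler_pM2l A0) !mulrDr !mulrA !mulfV ?gt_eqF// !mul1r.
lra.
Qed.

End plurisubharmonic_contact.

(** * Compact discs and the Cauchy estimate *)

Section compactness.
Context {R : realType}.
Local Notation Re := (@complex.Re R).
Local Notation Im := (@complex.Im R).

Lemma compact_disc (r : R) : compact [set l : R[i] | normc l <= r].
Proof.
pose f (p : R * R) : R[i] := p.1 +i* p.2.
have cf : continuous f.
  by move=> p; apply: continuous_complexD; [exact: cvg_fst|exact: cvg_snd].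
have cI : compact (`[- r, r] : set R) by exact: segment_compact.
have cS : compact (f @` (`[- r, r] `*` `[- r, r])).
  by apply: continuous_compact; [exact: continuous_subspaceT|exact: compact_setX].
apply: subclosed_compact cS _.
  rewrite (_ : mkset _ = (@normc R) @^-1` [set x | x <= r])//.
  by apply: preimage_closed; [move=> x _; exact: continuous_normc|exact: closed_le].
move=> l /= lr; exists (Re l, Im l); last by case: l {lr}.
split; rewrite /= in_itv/= -ler_norml; apply: le_trans lr.
  exact: normr_Re_le.
exact: normr_Im_le.
Qed.

Lemma compact_enorm_ball n (r : R) : compact [set w : 'rV[R[i]]_n | enorm w <= r].
Proof.
have cB := @rV_compact R[i] n (fun=> [set l : R[i] | normc l <= r]) (fun=> @compact_disc r).
apply: subclosed_compact cB _.
  rewrite (_ : mkset _ = (@enorm R n) @^-1` [set x | x <= r])//.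
  by apply: preimage_closed; [move=> x _; exact: continuous_enorm|exact: closed_le].
by move=> w /= wr j; apply: le_trans wr; exact: normc_le_enorm.
Qed.

End compactness.

Section cauchy_estimate.
Context {R : realType} {n : nat}.
Notation mu := (@lebesgue_measure R).
Local Notation Re := (@complex.Re R).

(** With [v] the derivative at [0], the mean value property is applied to
    [<F l - F 0, v> / l], whose limit at [0] is [|v|^2]. *)
Lemma cauchy_estimate (F : R[i] -> 'rV[R[i]]_n) (r s M : R) :
  (forall l, normc l < r -> derivable F l 1) -> 0 < s < r ->
  (forall l, normc l = s -> enorm (F l - F 0) <= M) ->
  enorm ('D_1 F 0) <= M / s.
Proof.
move=> dF /andP[s0 sr] FM.
have r0 : 0 < r by exact: lt_trans s0 sr.
set v := 'D_1 F 0.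
have dF0 : derivable F 0 1 by apply: dF; rewrite normc0.
pose g l := (hdot (F l) v + - hdot (F 0) v) * l^-1.
have gE l : g l = hdot (F l - F 0) v * l^-1 by rewrite /g hdotDl hdotNl.
have dg l : 0 < normc l < r -> derivable g l 1.
  move=> /andP[l0 lr]; apply: derivable_mulc.
    exact: (derivable_addc (@derivable_hdot R n F l v (dF l lr)) (@derivable_cstc R (- hdot (F 0) v) l)).
  apply: (@derivable_invc R (fun x => x) l (@derivable_idc R l)).
  by apply: contraTneq l0 => ->; rewrite normc0 ltxx.
have lim0 e : 0 < e -> exists2 d : R, 0 < d & forall l, 0 < normc l < d ->
    normc (g l - (sqn v)%:C) < e.
  move=> e0; have M0 : 0 < enorm v + 1 by rewrite ltr_wpDl// enorm_ge0.
  have e1 : 0 < e / (enorm v + 1) by rewrite divr_gt0.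
  have := derivable_littleo_enorm dF0 e1; rewrite -/v => /nbhs_normcP[d d0 Hd].
  exists d => // l /andP[l0 ld].
  have ln0 : l != 0 by apply: contraTneq l0 => ->; rewrite normc0 ltxx.
  have := Hd l; rewrite subr0 => /(_ ld) Hl.
  have -> : g l - (sqn v)%:C = hdot (F l - F 0 - l *: v) v * l^-1.
    by rewrite gE sqn_hdot !hdotDl !hdotNl hdotZl; field.
  rewrite normcM normcV ltr_pdivrMr//.
  apply: le_lt_trans (normc_hdot_le _ _) _.
  apply: (@le_lt_trans _ _ (e / (enorm v + 1) * normc l * enorm v)).
    by rewrite ler_wpM2r// enorm_ge0.
  rewrite mulrAC ltr_pM2r// mulrAC ltr_pdivrMr// ltr_pM2l//; lra.
have srr : 0 < s < r by rewrite s0.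
have := circle_mean dg lim0 srr; rewrite /= => mean.
have pi20 : 0 < 2 * pi :> R by rewrite mulr_gt0// pi_gt0.
have gb t : `|Re (g (s%:C * expi t)) - 0| <= M * enorm v / s.
  have ns : normc (s%:C * expi t) = s.
    by rewrite normcM normc_expi mulr1 normcR gtr0_norm.
  rewrite subr0 (le_trans (normr_Re_le _))// gE normcM normcV ns ler_wpM2r ?invr_ge0 ?(ltW s0)//.
  rewrite (le_trans (normc_hdot_le _ _))// ler_wpM2r ?enorm_ge0//; exact: FM.
have := @Rintegral_itv_approx R (fun t => Re (g (s%:C * expi t))) 0 (2 * pi) 0
  (M * enorm v / s) (ltW pi20).
rewrite mean mul0r !subr0 => H.
have {}H := H (fun t _ => @continuous_circle _ g r dg s srr t) (fun t _ => gb t).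
rewrite normrM [`|2 * pi|]gtr0_norm// ler_pM2r// in H.
rewrite ger0_norm ?sqn_ge0// -sqr_enorm in H.
have [v0|v0] := eqVneq (enorm v) 0.
  by rewrite v0 divr_ge0 ?(ltW s0)//; apply: le_trans (FM s%:C _); rewrite ?enorm_ge0// normcR gtr0_norm.
have v1 : 0 < enorm v by rewrite lt_def v0 enorm_ge0.
by rewrite -(ler_pM2r v1) -expr2 mulrAC.
Qed.

End cauchy_estimate.

(** * Maximum principle on a disc *)

Section pointwise_continuity.
Context {R : realType} {T : topologicalType}.
Implicit Types (f g : T -> R) (x : T).

Lemma continuous_atM f g x : {for x, continuous f} -> {for x, continuous g} ->
  {for x, continuous (fun y => f y * g y)}.
Proof. exact: cvgM. Qed.

Lemma continuous_atD f g x : {for x, continuous f} -> {for x, continuous g} ->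
  {for x, continuous (fun y => f y + g y)}.
Proof. exact: cvgD. Qed.

Lemma continuous_atB f g x : {for x, continuous f} -> {for x, continuous g} ->
  {for x, continuous (fun y => f y - g y)}.
Proof. exact: cvgB. Qed.

Lemma continuous_at_cst (c : R) x : {for x, continuous (fun _ : T => c)}.
Proof. exact: cvg_cst. Qed.

End pointwise_continuity.

Section truncation.
Context {R : realType}.

(** [ln (trunc x) + x] equals [1 + ln x] for [x <= 1] and [x] for [x >= 1]: both
    branches have the same value and slope at [1], and composed with a squared
    norm both are subharmonic. *)
Definition trunc (x : R) : R := Num.min x 1 * expR (1 - Num.min x 1).

Lemma trunc_ge1 x : 1 <= x -> trunc x = 1.
Proof. by move=> x1; rewrite /trunc min_r// subrr expR0 mulr1. Qed.

Lemma trunc_le1 x : x <= 1 -> trunc x = x * expR (1 - x).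
Proof. by move=> x1; rewrite /trunc min_l. Qed.

Lemma trunc0 : trunc 0 = 0.
Proof. by rewrite /trunc min_l ?ler01// mul0r. Qed.

Lemma trunc_le_1 x : 0 <= x -> trunc x <= 1.
Proof.
move=> x0; have [x1|/ltW x1] := leP x 1; last by rewrite trunc_ge1.
rewrite trunc_le1//; have := expR_ge1Dx (x - 1); rewrite addrC subrK => H.
rewrite -opprB expRN ler_pdivrMr ?expR_gt0// mul1r//.
Qed.

Lemma trunc_le_lin x : 0 <= x -> trunc x <= x * expR 1.
Proof.
move=> x0; apply: ler_pM; rewrite ?expR_ge0 ?le_min ?x0 ?ler01//.
  by rewrite ge_min lexx.
by rewrite ler_expR gerBl le_min x0 ler01.
Qed.

Lemma trunc_ge_ln x : 0 < x -> x * expR (1 - x) <= trunc x.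
Proof.
move=> x0; have [x1|x1] := leP x 1; first by rewrite trunc_le1.
rewrite (trunc_ge1 (ltW x1)); have := expR_ge1Dx (x - 1); rewrite addrC subrK => H.
by rewrite -opprB expRN ler_pdivrMr ?expR_gt0// mul1r.
Qed.

Lemma continuous_trunc : continuous trunc.
Proof.
move=> x; have cm : {for x, continuous (fun y : R => Num.min y 1)}.
  by apply: (@continuous_min _ _ id (cst 1)); [exact: cvg_id|exact: continuous_at_cst].
apply: (@continuous_atM R R (fun y => Num.min y 1) (fun y => expR (1 - Num.min y 1)) x cm).
apply: (@continuous_comp _ _ _ (fun y : R => 1 - Num.min y 1) (@expR R)); last exact: continuous_expR.
exact: (continuous_atB (@continuous_at_cst R R 1 x) cm).
Qed.

End truncation.

Section disc_estimate.
Context {R : realType} {n : nat}.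
Local Notation Re := (@complex.Re R).
Variables (Omega : set 'rV[R[i]]_n) (phi : 'rV[R[i]]_n -> R).
Hypotheses (oOmega : open Omega) (cphi : {within Omega, continuous phi})
  (pphi : plurisubharmonic Omega phi).
Variables (m delta eta D : R) (z : 'rV[R[i]]_n).
Hypotheses (delta0 : 0 < delta) (eta0 : 0 < eta) (etaD : eta <= D)
  (phi_le : forall y, Omega y -> phi y <= m)
  (phi_near : forall y, Omega y -> enorm (y - z) <= 2 * eta -> 3 * delta < phi y)
  (phi_far : forall y, Omega y -> D - 1 <= enorm (y - z) -> phi y < delta).
Variables (F : R[i] -> 'rV[R[i]]_n) (rho r : R).
Hypotheses (rho0 : 0 < rho) (rhor : rho < r) (F0 : F 0 = z)
  (OF : forall l, normc l < r -> Omega (F l))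
  (dF : forall l, normc l < r -> derivable F l 1).

(** [u] is the squared distance to [z] in units of [eta]; [X] is its value at
    distance [D], so that [min (u, X)] is bounded, and [A] is such that [A phi]
    is at most [X] where [u >= X] and at least [3 X] where [u <= 1]. *)
Let X := D ^+ 2 / eta ^+ 2.
Let A := X / delta.
Let b := (4 * rho ^+ 2)^-1.
Let u l := sqn (F l - z) / eta ^+ 2.

Let X1 : 1 <= X.
Proof.
rewrite /X ler_pdivlMr ?exprn_gt0// mul1r lerXn2r// ?nnegrE ?ltW//.
exact: lt_le_trans etaD.
Qed.

Let A0 : 0 < A.
Proof. by rewrite divr_gt0// (lt_le_trans _ X1). Qed.

Let Adelta : A * delta = X.
Proof. by rewrite /A divfK// gt_eqF. Qed.

Let b0 : 0 < b.
Proof. by rewrite invr_gt0 mulr_gt0// exprn_gt0. Qed.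

Let u_ge0 l : 0 <= u l.
Proof. by rewrite divr_ge0 ?sqn_ge0 ?sqr_ge0. Qed.

Let rho_r l : normc l <= rho -> normc l < r.
Proof. by move=> /le_lt_trans; apply. Qed.

(** [E] is the exponential of the function of [l] and of a translation [w] to
    which the maximum principle is applied. The maximum with [2 X] removes
    [head] where [min (u, X)] is not a subharmonic function of [l]; the term
    [b |l|^2] makes the Laplacian positive. *)
Let head K (p : R[i] * 'rV[R[i]]_n) := A * phi (F p.1 + p.2) - K * sqn p.2 + Num.min (u p.1) X.
Let E K p := expR (Num.max (head K p) (2 * X) + b * normc p.1 ^+ 2) *
  trunc (u p.1) / normc p.1.

Let Am : 3 * X < A * m.
Proof.
have Oz : Omega z by rewrite -F0; apply: OF; rewrite normc0 (lt_trans rho0).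
have : 3 * delta < m.
  apply: lt_le_trans (phi_le Oz); apply: phi_near => //.
  by rewrite subrr enormE sqn0 sqrtr0 mulr_ge0// ltW.
by rewrite -(ltr_pM2l A0) mulrCA Adelta.
Qed.

Let continuous_u l : normc l < r -> {for l, continuous u}.
Proof.
move=> lr; apply: (@continuous_atM R _ (fun l => sqn (F l - z)) (fun=> (eta ^+ 2)^-1)).
  2: exact: continuous_at_cst.
have -> : (fun l => sqn (F l - z)) = (fun l => enorm (F l - z) * enorm (F l - z)).
  by apply/funext => k; rewrite -expr2 sqr_enorm.
have cn : {for l, continuous (fun l => enorm (F l - z))}.
  apply: (@continuous_comp _ _ _ (fun l => F l - z) (@enorm R n)).
    by apply: (@cvgB _ _ _ (nbhs l)); [exact: derivable_continuous_rV (dF lr)|exact: cvg_cst].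
  exact: continuous_enorm.
exact: (continuous_atM cn cn).
Qed.

Let continuous_head K p : normc p.1 < r -> Omega (F p.1 + p.2) -> {for p, continuous (head K)}.
Proof.
move=> pr Op.
have cF : {for p, continuous (fun q : R[i] * 'rV[R[i]]_n => F q.1)}.
  apply: (@continuous_comp _ _ _ fst F); first exact: cvg_fst.
  exact: derivable_continuous_rV (dF pr).
have c2 : {for p, continuous (fun q : R[i] * 'rV[R[i]]_n => q.2)} by exact: cvg_snd.
have cu : {for p, continuous (fun q : R[i] * 'rV[R[i]]_n => u q.1)}.
  by apply: (@continuous_comp _ _ _ fst u); [exact: cvg_fst|exact: continuous_u].
have cn : {for p, continuous (fun q : R[i] * 'rV[R[i]]_n => enorm q.2)}.
  by apply: (@continuous_comp _ _ _ snd (@enorm R n)); [exact: cvg_snd|exact: continuous_enorm].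
have cs : {for p, continuous (fun q : R[i] * 'rV[R[i]]_n => sqn q.2)}.
  have -> : (fun q : R[i] * 'rV[R[i]]_n => sqn q.2) = (fun q => enorm q.2 * enorm q.2).
    by apply/funext => k; rewrite -expr2 sqr_enorm.
  exact: (continuous_atM cn cn).
have cp : {for p, continuous (fun q : R[i] * 'rV[R[i]]_n => phi (F q.1 + q.2))}.
  apply: (@continuous_comp _ _ _ (fun q : R[i] * 'rV[R[i]]_n => F q.1 + q.2) phi).
    exact: (cvgD cF c2).
  exact: (continuous_at_Omega oOmega cphi Op).
have cm : {for p, continuous (fun q : R[i] * 'rV[R[i]]_n => Num.min (u q.1) X)}.
  exact: (@continuous_min _ _ _ (cst X) p cu (@continuous_at_cst R _ X p)).
have cA := continuous_atM (@continuous_at_cst R _ A p) cp.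
have cK := continuous_atM (@continuous_at_cst R _ K p) cs.
exact: (continuous_atD (continuous_atB cA cK) cm).
Qed.

Let continuous_E K p : 0 < normc p.1 -> normc p.1 < r -> Omega (F p.1 + p.2) ->
  {for p, continuous (E K)}.
Proof.
move=> p0 pr Op.
have c1 : {for p, continuous (fun q : R[i] * 'rV[R[i]]_n => normc q.1)}.
  by apply: (@continuous_comp _ _ _ fst (@normc R)); [exact: cvg_fst|exact: continuous_normc].
have cu : {for p, continuous (fun q : R[i] * 'rV[R[i]]_n => u q.1)}.
  by apply: (@continuous_comp _ _ _ fst u); [exact: cvg_fst|exact: continuous_u].
have cV : {for p, continuous (fun q : R[i] * 'rV[R[i]]_n => (normc q.1)^-1)}.
  by apply: cvgV => //; rewrite gt_eqF.
have ct : {for p, continuous (fun q : R[i] * 'rV[R[i]]_n => trunc (u q.1))}.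
  apply: (@continuous_comp _ _ _ (fun q : R[i] * 'rV[R[i]]_n => u q.1) trunc) => //.
  exact: continuous_trunc.
have cm : {for p, continuous (fun q => Num.max (head K q) (2 * X))}.
  exact: (@continuous_max _ _ _ (cst (2 * X)) p (continuous_head pr Op) (@continuous_at_cst R _ _ p)).
have cb := continuous_atM (@continuous_at_cst R _ b p) (continuous_atM c1 c1).
have ce : {for p, continuous (fun q => expR (Num.max (head K q) (2 * X) + b * normc q.1 ^+ 2))}.
  apply: (@continuous_comp _ _ _ (fun q => Num.max (head K q) (2 * X) + b * normc q.1 ^+ 2) (@expR R)).
    exact: (continuous_atD cm cb).
  exact: continuous_expR.
exact: (continuous_atM (continuous_atM ce ct) cV).
Qed.

(** A uniform size for the translations allowed along the disc. *)
Let tube : exists2 t : R, 0 < t & forall l w, normc l <= rho -> enorm w <= t -> Omega (F l + w).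
Proof.
have /compact_near_coveringP H := @compact_disc R rho.
have := H _ (nbhs (0 : 'rV[R[i]]_n)) (fun w l => Omega (F l + w)) _.
have Hloc x : normc x <= rho ->
    \forall x' \near x & i \near (0 : 'rV[R[i]]_n), Omega (F x' + i).
  move=> xr.
  have cF : {for (x, 0 : 'rV[R[i]]_n), continuous (fun q : R[i] * 'rV[R[i]]_n => F q.1)}.
    apply: (@continuous_comp _ _ _ fst F); first exact: cvg_fst.
    exact: derivable_continuous_rV (dF (rho_r xr)).
  have c2 : {for (x, 0 : 'rV[R[i]]_n), continuous (fun q : R[i] * 'rV[R[i]]_n => q.2)} by exact: cvg_snd.
  have := cvgD cF c2; rewrite /= addr0.
  apply; apply: open_nbhs_nbhs; split => //; exact: OF (rho_r xr).
move=> /(_ (nbhs_filter _) Hloc) /nbhs_enormP[d d0 dP].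
exists (d / 2); first by rewrite divr_gt0.
move=> l w lr wd; apply: (dP w) => //.
by rewrite subr0; lra.
Qed.

(** At a point where [head] is at most [2 X], moving [l] towards [0] increases
    [E], unless [F l] is near [z], where cancelling the translation does. *)
Let no_max_low K t p : 0 < t -> t <= eta ->
  0 < normc p.1 < rho -> 0 < E K p -> enorm p.2 <= t -> Omega (F p.1) ->
  head K p <= 2 * X ->
  (E K (p.1, 0) <= E K p) ->
  (\forall c \near (0 : R), 0 < c -> E K ((1 - c)%:C * p.1, p.2) <= E K p) -> False.
Proof.
case: p => l w /= t0 te /andP[l0 lrho] Ep wt OFl low H0 Hc.
have tru0 : 0 < trunc (u l).
  by move: Ep; rewrite /E /= pmulr_lgt0 ?invr_gt0// pmulr_rgt0 ?expR_gt0.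
have u1 : 1 < u l.
  rewrite ltNge; apply/negP => u1; move: H0; apply/negP; rewrite -ltNge.
  rewrite /E /= ltr_pM2r ?invr_gt0// ltr_pM2r// ltr_expR ltrD2r.
  rewrite max_r// lt_max; apply/orP; left.
  rewrite /head /= sqn0 mulr0 subr0 addr0.
  have : 3 * delta < phi (F l).
    apply: phi_near => //; rewrite -(ler_pXn2r (ltn0Sn 1)) ?nnegrE ?enorm_ge0 ?mulr_ge0 ?(ltW eta0)//.
    rewrite sqr_enorm exprMn; move: u1; rewrite /u ler_pdivrMr ?exprn_gt0// mul1r.
    by have := sqr_ge0 eta; lra.
  rewrite -(ltr_pM2l A0) mulrCA Adelta.
  have : 0 <= Num.min (u l) X by rewrite le_min u_ge0 (le_trans ler01).
  by have := X1; lra.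
have lr : normc l < r by exact: lt_trans rhor.
have cl : {for (0 : R), continuous (fun c : R => (1 - c)%:C * l)}.
  apply: continuous_normcP => e e0.
  have e1 : 0 < e / normc l by rewrite divr_gt0.
  apply/nbhs_ballP; exists (e / normc l) => // c; rewrite -ball_normE /= sub0r normrN => cl.
  have -> : (1 - c)%:C * l - (1 - 0)%:C * l = (- c)%:C * l.
    by rewrite -mulrBl -rmorphB/=; congr (_%:C * _); ring.
  by rewrite normcM normcR normrN -ltr_pdivlMr.
have cul : {for (0 : R), continuous (fun c : R => u ((1 - c)%:C * l))}.
  apply: (@continuous_comp _ _ _ (fun c : R => (1 - c)%:C * l) u) => //.
  by rewrite subr0 mul1r; exact: continuous_u.
have near_u : \forall c \near (0 : R), 1 < u ((1 - c)%:C * l).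
  have u10 : 0 < u l - 1 by rewrite subr_gt0.
  move/cvgrPdist_lt : cul => /(_ _ u10); apply: filterS => c.
  rewrite subr0 mul1r ltr_norml => /andP[_]; lra.
have /nbhs_ballP[d /= d0 Hd] : \forall c \near (0 : R), 1 < u ((1 - c)%:C * l) /\
    (0 < c -> E K ((1 - c)%:C * l, w) <= E K (l, w)).
  by apply: filterS2 near_u Hc => c.
pose c := Num.min (d / 2) (1 / 2).
have c0 : 0 < c by rewrite lt_min !divr_gt0.
have c1 : c <= 1 / 2 by rewrite ge_min lexx orbT.
have cd : ball (0 : R) d c.
  rewrite -ball_normE /= sub0r normrN gtr0_norm//.
  have : c <= d / 2 by rewrite ge_min lexx.
  lra.
have [uc /(_ c0)] := Hd c cd.
have nc : normc ((1 - c)%:C * l) = (1 - c) * normc l.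
  by rewrite normcM normcR gtr0_norm//; lra.
rewrite /E /= !trunc_ge1 ?(ltW uc) ?(ltW u1)// !mulr1 nc.
rewrite leNgt => /negP; apply.
rewrite (max_r low).
have c1' : 0 < 1 - c by lra.
set N := normc l; set e' := expR (Num.max _ _ + _).
have -> : e' / ((1 - c) * N) = e' / (1 - c) / N by rewrite invfM mulrA.
rewrite ltr_pM2r ?invr_gt0// ltr_pdivlMr// {}/e'.
apply: (@lt_le_trans _ _ (expR (2 * X + b * ((1 - c) * N) ^+ 2))); last first.
  by rewrite ler_expR lerD2r le_max lexx orbT.
have -> : 2 * X + b * ((1 - c) * N) ^+ 2 = 2 * X + b * N ^+ 2 + - (b * N ^+ 2 * (2 * c - c ^+ 2)) by ring.
rewrite [ltRHS]expRD ltr_pM2l ?expR_gt0//.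
apply: lt_le_trans (expR_ge1Dx _).
have bN : b * N ^+ 2 <= 1 / 4.
  have NR : N ^+ 2 <= rho ^+ 2 by rewrite lerXn2r ?nnegrE ?ltW// ltW.
  rewrite /b mulrC ler_pdivrMr ?mulr_gt0 ?exprn_gt0//; lra.
have bN0 : 0 <= b * N ^+ 2 by rewrite mulr_ge0 ?sqr_ge0// ltW.
have : b * N ^+ 2 * (2 * c - c ^+ 2) <= 1 / 4 * (2 * c).
  rewrite ler_pM//; last by have := sqr_ge0 c; lra.
  have : c ^+ 2 <= c by rewrite expr2 ler_piMl//; lra.
  lra.
lra.
Qed.

(** Where [head] exceeds [2 X], the logarithm of [E] is bounded below by
    [A phi - K sqn + T], with equality at the point considered and [T] of
    positive Laplacian there. *)
Let no_max_high K p : 0 <= K ->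
  0 < normc p.1 < rho -> 0 < E K p -> enorm p.2 <= 1 -> Omega (F p.1 + p.2) ->
  2 * X < head K p ->
  (exists2 d : R, 0 < d & forall l y, normc (l - p.1) < d -> enorm (y - p.2) < d ->
    E K (l, y) <= E K p) -> False.
Proof.
case: p => l w /= K0 /andP[l0 lrho] Ep w1 Op high [d d0 Hd].
have lr : normc l < r by exact: lt_trans rhor.
have tru0 : 0 < trunc (u l).
  by move: Ep; rewrite /E /= pmulr_lgt0 ?invr_gt0// pmulr_rgt0 ?expR_gt0.
have u0 : 0 < u l.
  by rewrite lt_def u_ge0 andbT; apply: contraTneq tru0 => ->; rewrite trunc0 ltxx.
have uX : u l < X.
  rewrite ltNge; apply/negP => Xu; move: high; rewrite /head /= min_r//.
  have FD : D <= enorm (F l - z).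
    rewrite -(ler_pXn2r (ltn0Sn 1)) ?nnegrE ?enorm_ge0//; last first.
      by rewrite (le_trans _ etaD)// ltW.
    by rewrite sqr_enorm; move: Xu; rewrite /u /X ler_pM2r// invr_gt0 exprn_gt0.
  have : phi (F l + w) < delta.
    apply: phi_far => //.
    have := enormD (F l + w - z) (- w); rewrite enormN.
    have -> : F l + w - z - w = F l - z by rewrite addrAC addrK.
    lra.
  rewrite -(ltr_pM2l A0) Adelta.
  have : 0 <= K * sqn w by rewrite mulr_ge0// sqn_ge0.
  by lra.
have l_neq0 : l != 0 by apply: contraTneq l0 => ->; rewrite normc0 ltxx.
have near_r : \forall k \near l, normc k < r.
  have e0 : 0 < r - normc l by rewrite subr_gt0.
  apply: filterS (near_normc_lt l e0) => k kl.
  by have := normcD (k - l) l; rewrite subrK; lra.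
have dFz : \forall k \near l, derivable (fun k => F k - z) k 1.
  by apply: filterS near_r => k /dF dFk; exact: derivableB dFk (derivable_cst _ _ _).
have near_pos : \forall k \near l, 0 < normc k.
  apply: filterS (near_normc_lt l l0) => k kl.
  by have := normcD (l - k) k; rewrite subrK normcB; lra.
have cu := continuous_u lr.
have near_u0 : \forall k \near l, 0 < u k.
  move/cvgrPdist_lt : cu => /(_ _ u0); apply: filterS => k.
  by rewrite ltr_norml => /andP[_]; lra.
have near_uX : \forall k \near l, u k < X.
  have e0 : 0 < X - u l by rewrite subr_gt0.
  move/cvgrPdist_lt : cu => /(_ _ e0); apply: filterS => k.
  by rewrite ltr_norml => /andP[+ _]; lra.
have b4 : 0 < b / 4 by rewrite divr_gt0.
have sln := supported_lnVnormc b4 l_neq0.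
have sb := supportedZ (ltW b0) (supported_sqr_normc l).
have [T [s [s0 sT TE TEl]]] : exists T s, [/\ 0 < s, supported T l s,
    \forall k \near l, expR (T k) <= expR (u k + b * normc k ^+ 2) * trunc (u k) / normc k &
    expR (T l) = expR (u l + b * normc l ^+ 2) * trunc (u l) / normc l].
  have [u1|u1] := ltP 1 (u l).
    exists (fun k => (eta ^+ 2)^-1 * sqn (F k - z) + (- ln (normc k) + b * normc k ^+ 2)).
    exists ((eta ^+ 2)^-1 * 0 + (- (b / 4) + b * 1)).
    have TE k : 0 < normc k -> 1 < u k ->
        expR ((eta ^+ 2)^-1 * sqn (F k - z) + (- ln (normc k) + b * normc k ^+ 2)) =
        expR (u k + b * normc k ^+ 2) * trunc (u k) / normc k.
      move=> k0 /ltW uk; rewrite trunc_ge1// mulr1.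
      have -> : (normc k)^-1 = expR (- ln (normc k)) by rewrite expRN lnK.
      by rewrite -expRD; congr expR; rewrite /u; ring.
    have near_u1 : \forall k \near l, 1 < u k.
      have e0 : 0 < u l - 1 by rewrite subr_gt0.
      move/cvgrPdist_lt : cu => /(_ _ e0); apply: filterS => k.
      by rewrite ltr_norml => /andP[_]; lra.
    split.
    - by have := b0; lra.
    - apply: supportedD (supportedD sln sb).
      by apply: supportedZ; [rewrite invr_ge0 sqr_ge0|exact: supported_sqn].
    - by apply: filterS2 near_pos near_u1 => k k0 k1; rewrite TE.
    - exact: TE.
  have Fl : F l - z != 0.
    by apply: contraTneq u0 => Flz; rewrite /u Flz sqn0 mul0r ltxx.
  exists (fun k => ln (sqn (F k - z)) + (1 - ln (eta ^+ 2)) + (- ln (normc k) + b * normc k ^+ 2)).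
  exists (- (b / 4) + (- (b / 4) + b * 1)).
  have TE k : 0 < normc k -> 0 < u k ->
      expR (ln (sqn (F k - z)) + (1 - ln (eta ^+ 2)) + (- ln (normc k) + b * normc k ^+ 2)) =
      expR (u k + b * normc k ^+ 2) * (u k * expR (1 - u k)) / normc k.
    move=> k0 uk.
    have e20 : 0 < eta ^+ 2 by rewrite exprn_gt0.
    have sF : 0 < sqn (F k - z) by move: uk; rewrite /u pmulr_lgt0// invr_gt0.
    have -> : (normc k)^-1 = expR (- ln (normc k)) by rewrite expRN lnK.
    have -> : u k * expR (1 - u k) = expR (ln (u k) + (1 - u k)) by rewrite expRD lnK.
    have -> : ln (u k) = ln (sqn (F k - z)) - ln (eta ^+ 2).
      by rewrite /u lnM ?posrE ?invr_gt0// lnV ?posrE.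
    by rewrite -!expRD; congr expR; ring.
  split.
  - by have := b0; lra.
  - apply: supportedD (supportedD sln sb).
    exact: supportedDr (supported_ln_sqn b4 dFz Fl).
  - apply: filterS2 near_pos near_u0 => k k0 k1; rewrite TE//.
    rewrite ler_pM2r ?invr_gt0// ler_pM2l ?expR_gt0//.
    exact: trunc_ge_ln.
  - by rewrite TE// trunc_le1.
have dFl : \forall k \near l, derivable F k 1.
  by apply: filterS near_r => k; exact: dF.
apply: (@psh_disc_contact R n Omega phi oOmega cphi pphi F l w T A K s dFl Op A0 K0 s0 sT).
have EE k y : u k < X -> 2 * X < head K (k, y) -> E K (k, y) =
    expR (A * phi (F k + y) - K * sqn y) *
    (expR (u k + b * normc k ^+ 2) * trunc (u k) / normc k).
  move=> uk hk; rewrite /E /= max_l ?(ltW hk)// /head /= min_l ?(ltW uk)//.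
  rewrite [RHS](_ : _ = expR (A * phi (F k + y) - K * sqn y) *
      expR (u k + b * normc k ^+ 2) * trunc (u k) / normc k); last by rewrite !mulrA.
  by rewrite -expRD addrA.
have near_head : \forall q \near (l, w), 2 * X < head K q.
  have e0 : 0 < head K (l, w) - 2 * X by rewrite subr_gt0.
  have ch : {for (l, w), continuous (head K)} by exact: continuous_head.
  move/cvgrPdist_lt : ch => /(_ _ e0); apply: filterS => k.
  by rewrite ltr_norml => /andP[_]; lra.
case: near_head => -[/= Q1 Q2] [/= /nbhs_normcP[d1 d10 Q1d] /nbhs_enormP[d2 d20 Q2d]] Q.
have /nbhs_normcP[d3 d30 Hd3] : \forall k \near l, u k < X /\
    expR (T k) <= expR (u k + b * normc k ^+ 2) * trunc (u k) / normc k.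
  by apply: filterS2 near_uX TE => k.
exists (Num.min (Num.min d d1) (Num.min d2 d3)); first by rewrite !lt_min d0 d10 d20.
move=> k y; rewrite !lt_min => /andP[/andP[k1 k2] /andP[k3 k4]] /andP[/andP[y1 y2] /andP[y3 y4]].
have := Hd k y k1 y1.
have [ukX Tk] := Hd3 _ k4.
rewrite EE//; last by apply: (Q (k, y)); split; [exact: Q1d|exact: Q2d].
rewrite EE// -TEl -expRD => H.
rewrite -ler_expR; apply: le_trans H.
by rewrite expRD ler_wpM2l ?expR_ge0.
Qed.

(** The bound forces [F l] to stay within [eta] of [z] when [l] is small compared
    with the radius, uniformly in [F]. *)
Lemma disc_estimate l : 0 < normc l <= rho ->
  trunc (u l) <= expR (A * m + X + 1 / 4) * normc l / rho.
Proof.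
set C := expR _; have C0 : 0 < C by exact: expR_gt0.
move=> /andP[l0 lrho]; rewrite leNgt; apply/negP => Hl.
have [t' t'0 Ht'] := tube.
pose t := Num.min t' (Num.min 1 eta).
have t0 : 0 < t by rewrite !lt_min t'0 ltr01.
have t1 : t <= 1 by rewrite !ge_min lexx orbT.
have teta : t <= eta by rewrite !ge_min lexx !orbT.
have tube_t k y : normc k <= rho -> enorm y <= t -> Omega (F k + y).
  by move=> k1 y1; apply: Ht' => //; rewrite (le_trans y1)// ge_min lexx.
have Am0 : 0 < A * m by have := Am; have := X1; lra.
(* large enough for the maximum not to be reached at |w| = t *)
pose K := (A * m + 1) / t ^+ 2.
have K0 : 0 <= K by rewrite divr_ge0 ?sqr_ge0//; lra.
have bn k : normc k <= rho -> b * normc k ^+ 2 <= 1 / 4.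
  move=> kr; have NR : normc k ^+ 2 <= rho ^+ 2.
    by rewrite lerXn2r ?nnegrE ?normc_ge0// ltW.
  by rewrite /b mulrC ler_pdivrMr ?mulr_gt0 ?exprn_gt0//; lra.
have head_le p : Omega (F p.1 + p.2) -> head K p <= A * m + X.
  move=> Op; rewrite /head.
  have : A * phi (F p.1 + p.2) <= A * m by rewrite ler_pM2l// phi_le.
  have : 0 <= K * sqn p.2 by rewrite mulr_ge0// sqn_ge0.
  have : Num.min (u p.1) X <= X by rewrite ge_min lexx orbT.
  lra.
have E_le p : 0 < normc p.1 -> normc p.1 <= rho -> Omega (F p.1 + p.2) ->
    E K p <= C * trunc (u p.1) / normc p.1.
  move=> p0 p1 Op; rewrite /E ler_pM2r ?invr_gt0//; apply: ler_wpM2r.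
    by rewrite mulr_ge0 ?expR_ge0// le_min u_ge0 ler01.
  rewrite ler_expR lerD//; last exact: bn.
  rewrite ge_max head_le//=.
  by have := Am; have := X1; lra.
have rl : normc l < r by exact: le_lt_trans rhor.
have El : C / rho < E K (l, 0).
  rewrite /E /= ltr_pdivlMr//.
  apply: (@lt_le_trans _ _ (trunc (u l))); first by rewrite mulrAC.
  apply: ler_peMl; first by rewrite mulr_ge0 ?expR_ge0// le_min u_ge0 ler01.
  rewrite -[X in X <= _]expR0 ler_expR addr_ge0//; last by rewrite mulr_ge0 ?sqr_ge0// ltW.
  by rewrite le_max; apply/orP; right; have := X1; lra.
(* F being Lipschitz at 0, the bound holds on the circle of radius rho1 below *)
have dF0 : derivable F 0 1 by apply: dF; rewrite normc0 (lt_trans rho0).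
have := derivable_littleo_enorm dF0 ltr01; set v := 'D_1 F 0 => /nbhs_normcP[d d0 Hd].
pose L := enorm v + 1.
have L0 : 0 < L by rewrite ltr_wpDl// enorm_ge0.
have uL k : normc k < d -> u k <= (L / eta) ^+ 2 * normc k ^+ 2.
  move=> kd; have := Hd k; rewrite subr0 => /(_ kd); rewrite F0 mul1r => Hk.
  have FL : enorm (F k - z) <= L * normc k.
    have := enormD (F k - z - k *: v) (k *: v); rewrite subrK enormZ => /le_trans; apply.
    by rewrite /L [leRHS]mulrDl mul1r addrC lerD// mulrC.
  have -> : (L / eta) ^+ 2 * normc k ^+ 2 = (L * normc k) ^+ 2 / eta ^+ 2.
    by field; rewrite gt_eqF.
  rewrite /u ler_pM2r ?invr_gt0 ?exprn_gt0// -sqr_enorm lerXn2r// nnegrE ?enorm_ge0//.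
  by rewrite mulr_ge0 ?normc_ge0// ltW.
pose M := (L / eta) ^+ 2 * expR 1 * rho.
have M0 : 0 < M.
  by apply: mulr_gt0 => //; apply: mulr_gt0; [apply: exprn_gt0; exact: divr_gt0|exact: expR_gt0].
pose rho1 := Num.min (normc l / 2) (Num.min (d / 2) M^-1).
have rho10 : 0 < rho1 by rewrite !lt_min invr_gt0 M0 andbT; apply/andP; split; exact: divr_gt0.
have rho1l : rho1 <= normc l / 2 by rewrite ge_min lexx.
have rho1d : rho1 <= d / 2 by rewrite !ge_min lexx orbT.
have rho1M : rho1 * M <= 1 by rewrite -ler_pdivlMr// mul1r !ge_min lexx !orbT.
pose S := [set p : R[i] * 'rV[R[i]]_n |
  [/\ rho1 <= normc p.1, normc p.1 <= rho & enorm p.2 <= t]].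
have cS : compact S.
  have := @compact_setX _ _ _ _ (@compact_disc R rho) (@compact_enorm_ball R n t).
  have cl : closed [set p : R[i] * 'rV[R[i]]_n | rho1 <= normc p.1].
    rewrite (_ : mkset _ = (fun p : R[i] * 'rV[R[i]]_n => normc p.1) @^-1` [set x | rho1 <= x])//.
    apply: preimage_closed; last exact: closed_ge.
    move=> p _; apply: (@continuous_comp _ _ _ fst (@normc R)); first exact: cvg_fst.
    exact: continuous_normc.
  move=> /compact_closedI /(_ cl); congr compact.
  by apply/seteqP; split => p /= => [[[? ?] ?]|[? ? ?]]; split.
have lS : S (l, 0).
  split => //=; first by lra.
  by rewrite enormE sqn0 sqrtr0 ltW.
have SE p : S p -> [/\ 0 < normc p.1, normc p.1 < r & Omega (F p.1 + p.2)].
  move=> [p1 p2 p3]; split; [lra|exact: le_lt_trans rhor|exact: tube_t].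
have cE : {within S, continuous (E K)}.
  apply: continuous_in_subspaceT => p /set_mem /SE[? ? ?].
  exact: continuous_E.
have [[k w] /set_mem kS max] := compact_EVT_max (ex_intro _ _ lS) cS cE.
have Emax p : S p -> E K p <= E K (k, w) by move=> /mem_set; exact: max.
have Ek : C / rho < E K (k, w) by exact: lt_le_trans (Emax _ lS).
have [k0 kr Ok] := SE _ kS; case: (kS) => /= k1 k2 wt.
have Ekpos : 0 < E K (k, w) by apply: lt_trans Ek; rewrite divr_gt0.
have := E_le (k, w) k0 k2 Ok; rewrite /= => Eku.
have krho : normc k < rho.
  rewrite lt_neqAle k2 andbT; apply: contraTneq Ek => kE.
  rewrite -leNgt (le_trans Eku)// kE ler_pM2r ?invr_gt0// ger_pMr//.
  exact: trunc_le_1.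
have krho1 : rho1 < normc k.
  rewrite lt_neqAle k1 andbT; apply: contraTneq Ek => kE.
  rewrite -leNgt (le_trans Eku)// -mulrA ler_pM2l// ler_pdivrMr//.
  rewrite -kE mulrC ler_pdivlMr//.
  have kd : normc k < d by rewrite -kE (le_lt_trans rho1d)// ltr_pdivrMr// ltr_pMr// ltr1n.
  have := uL k kd; rewrite -kE => uk.
  apply: (@le_trans _ _ ((L / eta) ^+ 2 * rho1 ^+ 2 * expR 1 * rho)).
    rewrite ler_pM2r// (le_trans (trunc_le_lin (u_ge0 k)))//.
    by rewrite ler_pM2r ?expR_gt0.
  have -> : (L / eta) ^+ 2 * rho1 ^+ 2 * expR 1 * rho = rho1 * (rho1 * M) by rewrite /M; ring.
  by rewrite ler_piMr// ltW.
have kk : 0 < normc (k, w).1 < rho by rewrite /= k0.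
have Fk : Omega (F k) by exact: OF.
have [low|high] := leP (head K (k, w)) (2 * X).
  apply: (no_max_low t0 teta kk Ekpos wt Fk low).
    by apply: Emax; split => //=; rewrite enormE sqn0 sqrtr0 ltW.
  have e0 : 0 < 1 - rho1 / normc k by rewrite subr_gt0 ltr_pdivrMr// mul1r.
  apply/nbhs_ballP; exists (1 - rho1 / normc k) => //= c.
  rewrite -ball_normE /= sub0r normrN => cb c0; apply: Emax.
  rewrite gtr0_norm// in cb.
  have rk0 : 0 < rho1 / normc k by rewrite divr_gt0.
  have nc : normc ((1 - c)%:C * k) = (1 - c) * normc k.
    by rewrite normcM normcR gtr0_norm// subr_gt0 (lt_trans cb)// gtrBl.
  split => //=; rewrite nc.
    by rewrite -ler_pdivrMr// lerBrDl -lerBrDr ltW.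
  by apply: le_trans k2; rewrite ler_piMl ?(ltW k0)// gerBl ltW.
have wt' : enorm w < t.
  rewrite lt_neqAle wt andbT; apply: contraTneq high => wE.
  rewrite -leNgt /head /= -sqr_enorm wE /K divfK; last by rewrite gt_eqF// exprn_gt0.
  have H1 : A * phi (F k + w) <= A * m by rewrite ler_pM2l// phi_le.
  have H2 : Num.min (u k) X <= X by rewrite ge_min lexx orbT.
  by have H3 := X1; lra.
have w1 : enorm w <= 1 by exact: le_trans t1.
apply: (no_max_high K0 kk Ekpos w1 Ok high) => /=.
exists (Num.min (Num.min (normc k - rho1) (rho - normc k)) (t - enorm w)).
  by rewrite !lt_min !subr_gt0 krho krho1.
move=> k' y; rewrite !lt_min => /andP[/andP[B1 B2] _] /andP[_ B3]; apply: Emax.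
split => /=.
- by have H := normcD (k - k') k'; rewrite subrK normcB in H;
    rewrite ltrBrDr in B1; have := lt_le_trans B1 H; rewrite ltrD2l => /ltW.
- by have H := normcD (k' - k) k; rewrite subrK in H;
    rewrite ltrBrDr in B2; exact: le_trans H (ltW B2).
- by have H := enormD (y - w) w; rewrite subrK in H;
    rewrite ltrBrDr in B3; exact: le_trans H (ltW B3).
Qed.

End disc_estimate.

(** * Hyperbolicity *)

Lemma open_enorm_ball (R : realType) n (p : 'rV[R[i]]_n) (e : R) :
  open [set y | enorm (y - p) < e].
Proof.
rewrite openE => y /= ye; apply/nbhs_enormP; exists (e - enorm (y - p)).
  by rewrite subr_gt0.
move=> w wy; have := enormD (w - y) (y - p); rewrite subrKA => H.
by apply: le_lt_trans H _; rewrite -ltrBrDr.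
Qed.

Theorem theorem1 (R : realType) (n : nat) (Omega : set 'rV[R[i]]_n) :
  domain Omega -> ~ bounded_set Omega ->
  (exists phi : 'rV[R[i]]_n -> R, strong_antipeak Omega phi) ->
  kobayashi_hyperbolic Omega.
Proof.
move=> [_ oO _] _ [phi [bphi cphi phi0 pphi phiinf]] p Op.
have [m phi_le] : exists m, forall y, Omega y -> phi y <= m.
  have [M [_ HM]] := bphi; exists (M + 1) => y Oy.
  apply: le_trans (ler_norm _) _; apply: (HM (M + 1)) => //; lra.
pose delta := phi p / 4.
have delta0 : 0 < delta by rewrite divr_gt0// phi0.
have [e e0 He] : exists2 e : R, 0 < e & forall y, enorm (y - p) < e ->
    Omega y /\ 3 * delta < phi y.
  have e1 : 0 < phi p - 3 * delta by rewrite /delta; have := phi0 _ Op; lra.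
  have c := continuous_at_Omega oO cphi Op.
  have /nbhs_enormP[d d0 Hd] : \forall y \near p, 3 * delta < phi y.
    move/cvgrPdist_lt : c => /(_ _ e1); apply: filterS => y.
    by rewrite ltr_norml => /andP[_]; lra.
  have /nbhs_enormP[d' d'0 Hd'] : nbhs p Omega by exact: open_nbhs_nbhs.
  exists (Num.min d d'); first by rewrite lt_min d0.
  by move=> y; rewrite lt_min => /andP[y1 y2]; split; [exact: Hd'|exact: Hd].
pose eta := e / 4.
have eta0 : 0 < eta by rewrite divr_gt0.
have [M HM] := phiinf delta delta0.
pose D := 2 + `|M| + enorm p + 2 * eta.
have M0 := normr_ge0 M.
have p0 := enorm_ge0 p.
have etaD : eta <= D by rewrite /D; lra.
pose X := D ^+ 2 / eta ^+ 2; pose C := expR (X / delta * m + X + 1 / 4).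
have C1 : 1 <= C.
  have m0 : 0 < m by apply: lt_le_trans (phi_le _ Op); exact: phi0.
  have X0 : 0 <= X by rewrite divr_ge0 ?sqr_ge0.
  rewrite -[X in X <= _]expR0 ler_expR.
  have Xd : 0 <= X / delta * m by rewrite mulr_ge0 ?(ltW m0)// divr_ge0// ltW.
  by lra.
(* on the circle of radius theta rho the disc estimate gives trunc u <= 1/2 *)
pose theta := (2 * C)^-1.
have C0 : 0 < C by exact: lt_le_trans C1.
have theta0 : 0 < theta by rewrite /theta invr_gt0 mulr_gt0.
have thetaC : C * theta = 1 / 2.
  by rewrite /theta; field; rewrite gt_eqF// (lt_le_trans ltr01).
have theta1 : theta <= 1 / 2.
  by rewrite -thetaC ler_peMl// ltW.
exists [set y | enorm (y - p) < eta]; split.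
- exact: open_enorm_ball.
- by rewrite /= subrr enormE sqn0 sqrtr0.
- by move=> y /= yp; apply: (He y _).1; rewrite /eta in yp; lra.
exists (theta / (2 * eta)); first by rewrite divr_gt0// mulr_gt0.
move=> z v /= zp; apply: le_ereal_inf_tmp => _ [r [/= r0 [F [disc F0 Fv]]] <-].
rewrite lee_fin.
have OF l : normc l < r -> Omega (F l) by rewrite -ltcR => /disc[].
have dF l : normc l < r -> derivable F l 1 by rewrite -ltcR => /disc[].
pose rho := r / 2.
have rho0 : 0 < rho by rewrite divr_gt0.
have rhor : rho < r by rewrite /rho; lra.
have phi_near y : Omega y -> enorm (y - z) <= 2 * eta -> 3 * delta < phi y.
  move=> _ yz; apply: (He y _).2.
  have := enormD (y - z) (z - p); rewrite subrKA => /le_lt_trans; apply.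
  by rewrite /eta in zp yz *; lra.
have phi_far y : Omega y -> D - 1 <= enorm (y - z) -> phi y < delta.
  move=> Oy yz; apply: le_lt_trans (ler_norm _) _; apply: HM => //.
  have := enormD y (- z); rewrite enormN => yz'.
  have := enormD (z - p) p; rewrite subrK => zp'.
  have := ler_norm M; rewrite /D in yz; lra.
have est := disc_estimate oO cphi pphi delta0 eta0 etaD phi_le phi_near phi_far rho0 rhor F0 OF dF.
pose s := theta * rho.
have s0 : 0 < s by rewrite mulr_gt0.
have srho : s <= rho by rewrite /s ler_piMl ?(ltW rho0)//; lra.
have sr : 0 < s < r by rewrite s0 (le_lt_trans srho).
have circ l : normc l = s -> enorm (F l - F 0) <= eta.
  move=> ls; have := est l; rewrite ls s0 srho => /(_ isT).
  rewrite -/X -/C F0 /s mulrA mulfK ?gt_eqF// thetaC => tr.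
  have u1 : sqn (F l - z) / eta ^+ 2 <= 1.
    rewrite leNgt; apply/negP => /ltW u1; move: tr; rewrite trunc_ge1//; lra.
  rewrite -(ler_pXn2r (ltn0Sn 1)) ?nnegrE ?enorm_ge0 ?(ltW eta0)// sqr_enorm.
  by move: u1; rewrite ler_pdivrMr ?exprn_gt0// mul1r.
have := cauchy_estimate dF sr circ.
have -> : 'D_1 F 0 = v by rewrite -derive1E.
move=> vs.
have c0 : 0 < theta / (2 * eta) by rewrite divr_gt0// mulr_gt0.
apply: le_trans (ler_wpM2l (ltW c0) vs) _.
rewrite le_eqVlt; apply/orP; left; apply/eqP.
by rewrite /s /rho; field; rewrite !gt_eqF.
Qed.
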